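(* The semantic type-checking problem for the language $\mathrm{PERX}^-$ is undecidable: for every choice of the computable oracle functions $\mathit{content}$ and $\mathit{concat}$, there is no algorithm which, given a $\mathrm{PERX}^-$ expression $e$, an assignment $\Gamma$ of RX-types to the free variables of $e$ such that $e(\sigma)$ is defined for every $\sigma\in\Gamma$, and an RX-type $\tau$, decides whether $e(\sigma)\in\tau$ for every environment $\sigma\in\Gamma$.
   Context: **Values.** $\mathcal A$ is an infinite recursively enumerable set of atoms. Nodes are defined inductively: a node is an element node $\langle a:N\rangle$ or a data node $\langle a\rangle$, where $a\in\mathcal A$ and $N$ is a finite set of nodes. An item is an atom or a node. An RX-value is a finite set of items. **Types.** RX-types $\tau$ are generated by $\tau::=\mathbf{coll}(\iota)\mid\mathbf{single}(\iota)$; $\iota::=\mathbf{atom}\mid\nu\mid\iota\cup\iota$; $\nu::=\mathbf{data}\mid\mathbf{elem}(\gamma)\mid\nu\cup\nu$; $\gamma::=\mathbf{coll}(\nu)\mid\mathbf{single}(\nu)$. Denotations: $\mathbf{atom}$ is $\mathcal A$; $\mathbf{data}$ is the set of all data nodes; $\mathbf{elem}(\gamma)$ is the set of all $\langle a:N\rangle$ with $N$ in the denotation of $\gamma$; $\cup$ is union; $\mathbf{coll}(\iota)$ is the set of all finite subsets of the denotation of $\iota$; $\mathbf{single}(\iota)$ is the set of all singleton subsets of the denotation of $\iota$. Types are identified with their denotations. **Expressions.** $\mathrm{PERX}^-$ expressions are generated by $$e::=x\mid elem\{e\}\{e\}\mid name(e)\mid children(e)\mid()\mid e,e\mid for\ x\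 in\ e\ return\ e\mid if\ e\ eq\ e\ then\ e\ else\ e,$$ where $x$ ranges over an infinite set of variables. In ''$for\ x\ in\ e_1\ return\ e_2$'' the variable $x$ is bound in $e_2$; $FV(e)$ is the set of free variables of $e$. **Semantics.** Fix computable oracle functions $\mathit{content}$ (element nodes to atoms) and $\mathit{concat}$ (finite sets of atoms to atoms). For values $v,w$: $data(v)=\{a\mid a\in v \text{ an atom}\}\cup\{a\mid\langle a\rangle\in v\}\cup\{\mathit{content}(\langle a:N\rangle)\mid\langle a:N\rangle\in v\}$; $name(v)=\{a\}$ if $v=\{\langle a:N\rangle\}$, $name(\emptyset)=\{\mathit{concat}(\emptyset)\}$, undefined otherwise; $children(v)$ is undefined if $v$ contains an atom, and otherwise is $\bigcup\{N\mid\langle a:N\rangle\in v\}$; $construct(v,w)$ is undefined if $data(v)$ is not a singleton $\{a\}$, and otherwise is $\langle a:N\rangle$ with $N=\{\langle b\rangle\mid b\in w\text{ an atom}\}\cup\{i\in w\mid i\text{ a node}\}$. An environment $\sigma$ on $e$ maps each $x\in FV(e)$ to an RX-value; $x:v,\sigma$ denotes $\sigma$ updated to send $x$ to $v$. The partial semantics is: $x(\sigma)=\sigma(x)$; $elem\{e_1\}\{e_2\}(\sigma)=\{construct(e_1(\sigma),e_2(\sigma))\}$; $name(e)(\sigma)=name(e(\sigma))$; $children(e)(\sigma)=children(e(\sigma))$; $()(\sigma)=\emptyset$; $(e_1,e_2)(\sigma)=e_1(\sigma)\cup e_2(\sigma)$; $(for\ x\ in\ e_1\ return\ e_2)(\sigma)=\bigcup\{e_2(x:\{i\},\sigma)\mid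 i\in e_1(\sigma)\}$; $(if\ e_1\ eq\ e_2\ then\ e_3\ else\ e_4)(\sigma)$ is $e_3(\sigma)$ if $data(e_1(\sigma))=data(e_2(\sigma))=\{a\}$ for an atom $a$, is $e_4(\sigma)$ if $data(e_1(\sigma))=\{a\}$ and $data(e_2(\sigma))=\{b\}$ for atoms $a\ne b$, and is undefined otherwise. An expression is undefined whenever a value it refers to in its defining clause is undefined (branches not taken are not evaluated). **Type assignments.** A type assignment $\Gamma$ on $e$ maps each $x\in FV(e)$ to an RX-type. $\sigma\in\Gamma$ means that $\sigma$ and $\Gamma$ have the same domain and $\sigma(x)\in\Gamma(x)$ for all $x$. *)

(* Defs.v *)
From HB Require Import structures.
From mathcomp Require Import all_boot.
From mathcomp Require Import finmap.

Set Implicit Arguments.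
Unset Strict Implicit.
Unset Printing Implicit Defensive.

Local Open Scope fset_scope.
Local Open Scope fmap_scope.
Local Open Scope nat_scope.

(** * Partial recursive functions *)

Inductive recfun : nat -> Type :=
| RZero k : recfun k
| RSucc : recfun 1
| RProj k of 'I_k : recfun k
| RComp k m of recfun m & ('I_m -> recfun k) : recfun k
| RPrec k of recfun k & recfun k.+2 : recfun k.+1
| RMin k of recfun k.+1 : recfun k.

(** [revalto f v y]: the partial function denoted by [f] is defined on [v],
    with value [y]. In the clause of [RPrec], [s] lists the successive values
    of the recursion. *)
Fixpoint revalto k (f : recfun k) : k.-tuple nat -> nat -> Prop :=
  match f in recfun k return k.-tuple nat -> nat -> Prop with
  | RZero _ => fun _ y => y = 0
  | RSucc => fun v y => y = (thead v).+1
  | RProj _ i => fun v y => y = tnth v i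
  | RComp _ m g h => fun v y =>
      exists w : m.-tuple nat,
        (forall i, revalto (h i) v (tnth w i)) /\ revalto g w y
  | RPrec _ g h => fun v y =>
      exists s : nat -> nat,
        [/\ revalto g [tuple of behead v] (s 0),
            forall i, i < thead v ->
              revalto h [tuple of i :: s i :: behead v] (s i.+1)
          & y = s (thead v)]
  | RMin _ g => fun v y =>
      revalto g [tuple of y :: v] 0 /\
      forall i, i < y -> exists z, revalto g [tuple of i :: v] z.+1
  end.

Definition recursively_enumerable (P : nat -> Prop) : Prop :=
  exists f : recfun 1, forall n, P n <-> exists y, revalto f [tuple n] y.

(** [f] may behave arbitrarily (it may diverge) on codes of inputs that
    violate [promise], and on numbers that are not codes. *)
Definition decides_under I (code : I -> nat) (promise P : I -> Prop)
    (f : recfun 1) : Prop :=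
  forall i, promise i ->
    (P i -> revalto f [tuple code i] 1) /\
    (~ P i -> revalto f [tuple code i] 0).

(** Cantor's pairing function (m + n)(m + n + 1)/2 + n. *)
Definition npair (m n : nat) : nat := 'C((m + n).+1, 2) + n.

Definition code_seq (s : seq nat) : nat :=
  foldr (fun m c => (npair m c).+1) 0 s.

(** * Atoms *)

(** A [countType] carries an injective numbering [choice.pickle]; its range
    is the set of natural numbers representing the atoms. *)
Definition infinite_re (A : countType) : Prop :=
  (forall s : seq A, exists a, a \notin s) /\
  recursively_enumerable (fun n => exists a : A, choice.pickle a = n).

(** * Nodes *)

(** Trees present nodes by listing sets of children, in any order and possibly
    with repetitions. *)
Inductive tree (A : Type) : Type :=
| TData of A
| TElem of A & seq (tree A).

Section TreeChoice.
Variable A : Type.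

Fixpoint gentree_of (t : tree A) : GenTree.tree A :=
  match t with
  | TData a => GenTree.Leaf a
  | TElem a s => GenTree.Node 0 (GenTree.Leaf a :: map gentree_of s)
  end.

Fixpoint tree_of (g : GenTree.tree A) : option (tree A) :=
  match g with
  | GenTree.Leaf a => Some (TData a)
  | GenTree.Node _ (GenTree.Leaf a :: gs) => Some (TElem a (pmap tree_of gs))
  | GenTree.Node _ _ => None
  end.

Lemma tree_nested_ind (P : tree A -> Prop) :
  (forall a, P (TData a)) ->
  (forall a s, (forall i, i < size s -> P (nth (TData a) s i)) ->
     P (TElem a s)) ->
  forall t, P t.
Proof.
move=> Pd Pe; fix IH 1 => -[a|a s]; first exact: Pd.
apply: Pe; elim: s => [|t s IHs] i; first by clear IH.
by case: i => [_|i lt_i]; [exact: IH | exact: (IHs i lt_i)].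
Qed.

Lemma gentree_ofK : pcancel gentree_of tree_of.
Proof.
elim/tree_nested_ind=> //= a s IH; congr (Some (TElem _ _)).
elim: s IH => //= t s IHs IH; rewrite (IH 0) //=; congr cons.
by apply: IHs => i; apply: (IH i.+1).
Qed.

End TreeChoice.

HB.instance Definition _ (A : eqType) :=
  Equality.copy (tree A) (pcan_type (@gentree_ofK A)).
HB.instance Definition _ (A : choiceType) :=
  Choice.copy (tree A) (pcan_type (@gentree_ofK A)).

(** Since [enum_fset] maps distinct finite sets to distinct lists, each node
    has exactly one presentation in which all lists are values of
    [enum_fset]. *)
Fixpoint canonical (A : choiceType) (t : tree A) : bool :=
  match t with
  | TData _ => true
  | TElem _ s => all (@canonical A) s && (s == enum_fset [fset u in s])
  end.

Record node (A : choiceType) := Node {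
  node_tree :> tree A;
  node_canonical : canonical node_tree }.

HB.instance Definition _ (A : choiceType) := [isSub for @node_tree A].
HB.instance Definition _ (A : choiceType) := [Choice of node A by <:].

Section Nodes.
Variable A : choiceType.
Implicit Types (a b : A) (M N : {fset node A}).

Definition data_node a : node A := @Node A (TData a) isT.

Definition child_trees N : seq (tree A) :=
  enum_fset [fset node_tree n | n in N].

Lemma elem_node_subproof a N : canonical (TElem a (child_trees N)).
Proof.
rewrite /=; apply/andP; split.
  by apply/allP=> t /imfsetP[n _ ->]; apply: node_canonical.
by apply/eqP; congr enum_fset; apply/fsetP=> t; rewrite !inE.
Qed.

Definition elem_node a N : node A := Node (elem_node_subproof a N).

Lemma data_node_inj : injective data_node.
Proof. by move=> a b []. Qed.

Lemma elem_node_inj a b M N :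
  elem_node a M = elem_node b N -> a = b /\ M = N.
Proof.
case=> -> /val_inj eqMN; split=> //; apply/fsetP=> n.
have mem_val (L : {fset node A}) :
    (node_tree n \in [fset node_tree m | m in L]) = (n \in L).
  by apply: mem_imfset; apply: val_inj.
by rewrite -!mem_val eqMN.
Qed.

Lemma data_elem_node_neq a b N : data_node a <> elem_node b N.
Proof. by []. Qed.

Lemma node_nested_ind (P : node A -> Prop) :
  (forall a, P (data_node a)) ->
  (forall a N, (forall n, n \in N -> P n) -> P (elem_node a N)) ->
  forall n, P n.
Proof.
move=> Pd Pe [t]; elim/tree_nested_ind: t => [a|a s IH] ct.
  by rewrite (_ : Node ct = data_node a) //; apply: val_inj.
have /andP[/allP cs /eqP ds] := ct.
pose N : {fset node A} := [fset n in pmap insub s].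
have memN n : (n \in N) = (node_tree n \in s).
  by rewrite !inE mem_pmap_sub.
rewrite (_ : Node ct = elem_node a N).
  apply: Pe => n; rewrite memN => /(nthP (TData a))[i lt_i def_n].
  have := IH i lt_i; rewrite def_n => /(_ (node_canonical n)).
  by case: n {def_n}.
apply: val_inj; congr TElem; rewrite /= {1}ds; congr enum_fset.
apply/fsetP=> t; rewrite !inE; apply/idP/imfsetP => [st|[n /= + ->]].
  by exists (Node (cs t st)); rewrite //= memN.
by rewrite memN.
Qed.

(** The inverse of the constructors of nodes. *)
Definition node_view (n : node A) : A + A * {fset node A} :=
  match node_tree n with
  | TData a => inl a
  | TElem a s => inr (a, [fset m in pmap insub s])
  end.

Lemma node_view_data a : node_view (data_node a) = inl a.
Proof. by []. Qed.

Lemma node_view_elem a N : node_view (elem_node a N) = inr (a, N).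
Proof.
congr (inr (_, _)); apply/fsetP=> n; rewrite !inE mem_pmap_sub.
by rewrite mem_imfset //; apply: val_inj.
Qed.

(** The node presented by a tree. *)
Fixpoint node_of_tree (t : tree A) : node A :=
  match t with
  | TData a => data_node a
  | TElem a s => elem_node a [fset n in map node_of_tree s]
  end.

End Nodes.

(** * Values and types *)

Definition item (A : choiceType) : choiceType := (A + node A)%type.

Definition value (A : choiceType) : choiceType := {fset item A}.

Inductive multiplicity (T : Type) : Type := Coll of T | Single of T.

Inductive ntype : Type :=
| TyData
| TyElem of multiplicity ntype
| TyNUnion of ntype & ntype.

Inductive itype : Type :=
| TyAtom
| TyNode of ntype
| TyUnion of itype & itype.

Definition rxtype : Type := multiplicity itype.

Section Denotations.
Variable A : choiceType.

Definition in_multiplicity (T : Type) (K : choiceType) (den : T -> K -> Prop)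
    (m : multiplicity T) (V : {fset K}) : Prop :=
  match m with
  | Coll t => forall k, k \in V -> den t k
  | Single t => exists k, den t k /\ V = [fset k]
  end.

Fixpoint in_ntype (nu : ntype) (n : node A) : Prop :=
  match nu with
  | TyData => exists a, n = data_node a
  | TyElem g => exists a N, n = elem_node a N /\ in_multiplicity in_ntype g N
  | TyNUnion nu1 nu2 => in_ntype nu1 n \/ in_ntype nu2 n
  end.

Fixpoint in_itype (iota : itype) (i : item A) : Prop :=
  match iota with
  | TyAtom => exists a, i = inl a
  | TyNode nu => exists n, i = inr n /\ in_ntype nu n
  | TyUnion iota1 iota2 => in_itype iota1 i \/ in_itype iota2 i
  end.

Definition in_rxtype (tau : rxtype) (v : value A) : Prop :=
  in_multiplicity in_itype tau v.

End Denotations.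

(** * Expressions *)

Definition var : Type := nat.

Inductive expr : Type :=
| EVar of var
| EElem of expr & expr
| EName of expr
| EChildren of expr
| EEmpty
| EConcat of expr & expr
| EFor of var & expr & expr
| EIf of expr & expr & expr & expr.

(** [EFor x e1 e2] stands for "for x in e1 return e2". *)
Fixpoint FV (e : expr) : {fset nat} :=
  match e with
  | EVar x => [fset x]
  | EElem e1 e2 => FV e1 `|` FV e2
  | EName e1 => FV e1
  | EChildren e1 => FV e1
  | EEmpty => fset0
  | EConcat e1 e2 => FV e1 `|` FV e2
  | EFor x e1 e2 => FV e1 `|` (FV e2 `\ x)
  | EIf e1 e2 e3 e4 => FV e1 `|` FV e2 `|` FV e3 `|` FV e4
  end.

(** * Semantics *)

Definition env (A : choiceType) : Type := {fmap nat -> value A}.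

Definition fset_the (K : choiceType) (V : {fset K}) : option K :=
  if enum_fset V is [:: k] then Some k else None.

Section Semantics.
Variables (A : choiceType).
(** [content a N] is the value of the oracle on the element node with label [a]
    and set of children [N]. *)
Variables (content : A -> {fset node A} -> A) (concat : {fset A} -> A).

Definition item_data (i : item A) : A :=
  match i with
  | inl a => a
  | inr n => match node_view n with
             | inl a => a
             | inr (a, N) => content a N
             end
  end.

Definition data (v : value A) : {fset A} := [fset item_data i | i in v].

Definition name (v : value A) : option (value A) :=
  match enum_fset v with
  | [::] => Some [fset inl (concat fset0)]
  | [:: inr n] =>
      if node_view n is inr (a, _) then Some [fset inl a] else None
  | _ => None
  end.

Definition node_children (n : node A) : {fset node A} :=
  if node_view n is inr (_, N) then N else fset0.

Definition item_children (i : item A) : option (value A) :=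
  if i is inr n then Some [fset inr m | m in node_children n] else None.

(** The union of the values [F i], undefined if one of them is. *)
Definition union_over (v : value A) (F : item A -> option (value A)) :
    option (value A) :=
  if all (fun i => isSome (F i)) v
  then Some (\bigcup_(i <- v) odflt fset0 (F i)) else None.

Definition children (v : value A) : option (value A) :=
  union_over v item_children.

Definition item_node (i : item A) : node A :=
  match i with inl b => data_node b | inr n => n end.

Definition construct (v w : value A) : option (node A) :=
  omap (fun a => elem_node a [fset item_node i | i in w]) (fset_the (data v)).

Fixpoint eval (e : expr) (sigma : env A) : option (value A) :=
  match e with
  | EVar x => sigma.[? x]
  | EElem e1 e2 =>
      if (eval e1 sigma, eval e2 sigma) is (Some v, Some w)
      then omap (fun n => [fset inr n]) (construct v w) else None
  | EName e1 => obind name (eval e1 sigma)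
  | EChildren e1 => obind children (eval e1 sigma)
  | EEmpty => Some fset0
  | EConcat e1 e2 =>
      if (eval e1 sigma, eval e2 sigma) is (Some v, Some w)
      then Some (v `|` w) else None
  | EFor x e1 e2 =>
      if eval e1 sigma is Some v
      then union_over v (fun i => eval e2 sigma.[x <- [fset i]]) else None
  | EIf e1 e2 e3 e4 =>
      if (eval e1 sigma, eval e2 sigma) is (Some v, Some w) then
        if (fset_the (data v), fset_the (data w)) is (Some a, Some b)
        then if a == b then eval e3 sigma else eval e4 sigma
        else None
      else None
  end.

End Semantics.

(** * Computability of the oracles *)

Section Oracles.
Variable A : countType.

Fixpoint code_tree (t : tree A) : nat :=
  match t with
  | TData a => npair 0 (choice.pickle a)
  | TElem a s => npair 1 (npair (choice.pickle a) (code_seq (map code_tree s)))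
  end.

(** An algorithm for an oracle has to work for any presentation of its
    argument, by a tree or by a list of atoms. *)
Definition computable_content (content : A -> {fset node A} -> A) : Prop :=
  exists f : recfun 1, forall (a : A) (s : seq (tree A)),
    revalto f [tuple code_tree (TElem a s)]
      (choice.pickle (content a [fset n in map (@node_of_tree A) s])).

Definition computable_concat (concat : {fset A} -> A) : Prop :=
  exists f : recfun 1, forall s : seq A,
    revalto f [tuple code_seq (map choice.pickle s)]
      (choice.pickle (concat [fset a in s])).

End Oracles.

(** * The type-checking problem *)

Definition type_assignment : Type := {fmap nat -> rxtype}.

Definition in_assignment (A : choiceType) (sigma : env A)
    (Gamma : type_assignment) : Prop :=
  domf sigma = domf Gamma /\
  forall x v tau, sigma.[? x] = Some v -> Gamma.[? x] = Some tau ->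
    in_rxtype tau v.

Record instance : Type := Instance {
  inst_expr : expr;
  inst_assignment : type_assignment;
  inst_type : rxtype }.

Section Problem.
Variables (A : choiceType).
Variables (content : A -> {fset node A} -> A) (concat : {fset A} -> A).

Definition valid_instance (I : instance) : Prop :=
  domf (inst_assignment I) = FV (inst_expr I) /\
  forall sigma : env A, in_assignment sigma (inst_assignment I) ->
    exists v, eval content concat (inst_expr I) sigma = Some v.

Definition type_checks (I : instance) : Prop :=
  forall sigma : env A, in_assignment sigma (inst_assignment I) ->
    exists v, eval content concat (inst_expr I) sigma = Some v /\
      in_rxtype (inst_type I) v.

End Problem.

Definition code_multiplicity (T : Type) (code : T -> nat)
    (m : multiplicity T) : nat :=
  match m with
  | Coll t => npair 0 (code t)
  | Single t => npair 1 (code t)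
  end.

Fixpoint code_ntype (nu : ntype) : nat :=
  match nu with
  | TyData => npair 0 0
  | TyElem g => npair 1 (code_multiplicity code_ntype g)
  | TyNUnion nu1 nu2 => npair 2 (npair (code_ntype nu1) (code_ntype nu2))
  end.

Fixpoint code_itype (iota : itype) : nat :=
  match iota with
  | TyAtom => npair 0 0
  | TyNode nu => npair 1 (code_ntype nu)
  | TyUnion iota1 iota2 => npair 2 (npair (code_itype iota1) (code_itype iota2))
  end.

Definition code_rxtype (tau : rxtype) : nat := code_multiplicity code_itype tau.

Fixpoint code_expr (e : expr) : nat :=
  match e with
  | EVar x => npair 0 x
  | EElem e1 e2 => npair 1 (npair (code_expr e1) (code_expr e2))
  | EName e1 => npair 2 (code_expr e1)
  | EChildren e1 => npair 3 (code_expr e1)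
  | EEmpty => npair 4 0
  | EConcat e1 e2 => npair 5 (npair (code_expr e1) (code_expr e2))
  | EFor x e1 e2 => npair 6 (npair x (npair (code_expr e1) (code_expr e2)))
  | EIf e1 e2 e3 e4 =>
      npair 7 (npair (code_expr e1) (npair (code_expr e2)
        (npair (code_expr e3) (code_expr e4))))
  end.

(** The list of the pairs (x, Gamma(x)), by increasing x. *)
Definition code_assignment (Gamma : type_assignment) : nat :=
  code_seq [seq npair x (oapp code_rxtype 0 Gamma.[? x])
           | x <- sort leq (domf Gamma)].

Definition code_instance (I : instance) : nat :=
  npair (code_expr (inst_expr I))
    (npair (code_assignment (inst_assignment I)) (code_rxtype (inst_type I))).

(** * Injectivity of the codes *)

Lemma npair_inj m n m' n' : npair m n = npair m' n' -> m = m' /\ n = n'.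
Proof.
have lt_pair k l k' l' : k + l < k' + l' -> npair k l < npair k' l'.
  move=> lt_kl; apply: leq_trans (leq_addr _ _).
  apply: (@leq_trans 'C((k + l).+2, 2)); last by apply: leq_bin2l.
  by rewrite binS bin1 /npair ltn_add2l ltnS leq_addl.
move=> eq_p; case: (ltngtP (m + n) (m' + n')) => [/lt_pair|/lt_pair|eq_s].
- by rewrite eq_p ltnn.
- by rewrite eq_p ltnn.
move: eq_p; rewrite /npair eq_s => /addnI eq_n; split=> //.
by move: eq_s; rewrite eq_n => /addIn.
Qed.

Lemma code_seq_inj : injective code_seq.
Proof.
by elim=> [|m s IH] [|m' s'] //= [] /npair_inj[-> /IH->].
Qed.

Lemma code_ntype_inj : injective code_ntype.
Proof.
rewrite /injective; fix IH 1.
case=> [|[nu|nu]|nu1 nu2] [|[nu'|nu']|nu1' nu2'] /= /npair_inj[].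
all: try by clear IH.
- by move=> _ /npair_inj[_ /(IH nu)->].
- by clear IH => _ /npair_inj[].
- by clear IH => _ /npair_inj[].
- by move=> _ /npair_inj[_ /(IH nu)->].
- by move=> _ /npair_inj[/(IH nu1)-> /(IH nu2)->].
Qed.

Lemma code_itype_inj : injective code_itype.
Proof.
elim=> [|nu|i1 IH1 i2 IH2] [|nu'|i1' i2'] /= /npair_inj[//] _.
- by move/code_ntype_inj->.
- by case/npair_inj=> /IH1-> /IH2->.
Qed.

Lemma code_rxtype_inj : injective code_rxtype.
Proof. by case=> i [] i' /npair_inj[//] _ /code_itype_inj->. Qed.

Lemma code_expr_inj : injective code_expr.
Proof.
elim=> [x|e1 IH1 e2 IH2|e1 IH1|e1 IH1||e1 IH1 e2 IH2|x e1 IH1 e2 IH2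
       |e1 IH1 e2 IH2 e3 IH3 e4 IH4]
  [x'|e1' e2'|e1'|e1'||e1' e2'|x' e1' e2'|e1' e2' e3' e4'] /= /npair_inj[//] _.
- by move->.
- by case/npair_inj=> /IH1-> /IH2->.
- by move/IH1->.
- by move/IH1->.
- by case/npair_inj=> /IH1-> /IH2->.
- by case/npair_inj=> -> /npair_inj[/IH1-> /IH2->].
- by case/npair_inj=> /IH1-> /npair_inj[/IH2-> /npair_inj[/IH3-> /IH4->]].
Qed.

Lemma code_assignment_inj : injective code_assignment.
Proof.
move=> G H /code_seq_inj eqGH.
have /andP[/eqP eq_s /allP eq_v] :
    (sort leq (domf G) == sort leq (domf H)) &&
    all (fun x => oapp code_rxtype 0 G.[? x] == oapp code_rxtype 0 H.[? x])
      (sort leq (domf G)).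
  elim: (sort leq (domf G)) (sort leq (domf H)) eqGH => [|x s IHs] [|y t] //=.
  by case=> /npair_inj[<- ->] /IHs/andP[/eqP-> ->]; rewrite !eqxx.
have eqD : domf G = domf H.
  by apply/fsetP=> x; rewrite -(mem_sort leq) eq_s mem_sort.
apply/fmapP=> x; case: (boolP (x \in domf G)) => [Gx|nGx]; last first.
  have nHx : x \notin domf H by rewrite -eqD.
  by rewrite (not_fnd nGx) (not_fnd nHx).
have Hx : x \in domf H by rewrite -eqD.
have := eq_v x; rewrite mem_sort => /(_ Gx)/eqP.
by rewrite (in_fnd Gx) (in_fnd Hx) => /= /code_rxtype_inj->.
Qed.

Lemma code_instance_inj : injective code_instance.
Proof.
case=> e G t [e' G' t'] /npair_inj[/= /code_expr_inj-> /npair_inj[]].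
by move=> /code_assignment_inj-> /code_rxtype_inj->.
Qed.

(* Main.v *)
Require Import Defs.
From mathcomp Require Import all_boot.
From mathcomp Require Import finmap.

(** Since name(()) = concat of the empty set is an atom, while the name of a
    singleton is its label, testing name(e) against name(()) tests e for
    emptiness as soon as an atom c different from concat of the empty set is at
    hand. So PERX^- expresses negation, and with it first-order logic over a
    database consisting of a finite set of atoms with a linear order (an initial
    segment of the natural numbers) and a finite set of finite sequences.
    A recursive function f translates into a formula saying that f(x) = y, in
    which the values of each primitive recursion are looked for among the
    sequences of the database; f(m) = y holds iff some database satisfies it.
    Given a decision procedure, let F(x) be its answer to whether the expression
    with code x, in which one free variable is bound to the number x,
    type-checks. When x is the code of the expression testing whether F takes a
    nonzero value, this instance type-checks iff F(x) = 0: a contradiction. *)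

Set Implicit Arguments.
Unset Strict Implicit.
Unset Printing Implicit Defensive.

Local Open Scope fset_scope.
Local Open Scope fmap_scope.
Local Open Scope nat_scope.

(** * Computable functions *)

Lemma revalto_functional k (f : recfun k) v y z :
  revalto f v y -> revalto f v z -> y = z.
Proof.
elim: f v y z => {k} [k||k i|k m g IHg h IHh|k g IHg h IHh|k g IHg] v y z /=.
- by move=> -> ->.
- by move=> -> ->.
- by move=> -> ->.
- case=> w [hw gw] [w' [hw' gw']].
  suff eq_w : w = w' by rewrite -eq_w in gw'; apply: IHg gw gw'.
  by apply: eq_from_tnth => i; apply: IHh (hw i) (hw' i).
- case=> s [gs hs ->] [t [gt ht ->]].
  suff eq_st i : i <= thead v -> s i = t i by apply: eq_st.
  elim: i => [_|i IHi lt_i]; first exact: IHg gs gt.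
  have := hs i lt_i; rewrite (IHi (ltnW lt_i)) => hsi.
  exact: IHh hsi (ht i lt_i).
- case=> gy ltg [gz ltg']; case: (ltngtP y z) => // lt_yz.
  + by have [x /(IHg _ _ _ gy)] := ltg' _ lt_yz.
  + by have [x /(IHg _ _ _ gz)] := ltg _ lt_yz.
Qed.

(** Restricted to total functions: the only use is to show that the diagonal map on codes is
    recursive. *)
Definition computable k (F : k.-tuple nat -> nat) : Prop :=
  exists f : recfun k, forall v, revalto f v (F v).

Lemma computable_proj k (i : 'I_k) : computable (fun v => tnth v i).
Proof. by exists (RProj i). Qed.

Lemma computable_comp k m (G : m.-tuple nat -> nat)
    (H : 'I_m -> k.-tuple nat -> nat) :
  computable G -> (forall i, computable (H i)) ->
  computable (fun v => G [tuple H i v | i < m]).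
Proof.
(* Only the existence of a program for each [H i] is known, so the family [h] is assembled by
   induction on [m]. *)
move=> [g gP] Hc; have [h hP] : exists h : 'I_m -> recfun k,
    forall i v, revalto (h i) v (H i v).
  elim: m {G g gP} H Hc => [|m IH] H Hc.
    by exists (fun i => RZero k); case.
  have [h hP] := IH _ (fun i => Hc (lift ord0 i)).
  have [h0 h0P] := Hc ord0.
  exists (fun i => oapp h h0 (unlift ord0 i)) => i v.
  by case: unliftP => [j ->|->] /=.
exists (RComp g h) => v; exists [tuple H i v | i < m]; split=> // i.
by rewrite tnth_mktuple.
Qed.

Lemma eq_computable k (F G : k.-tuple nat -> nat) :
  F =1 G -> computable F -> computable G.
Proof. by move=> eqFG [f fP]; exists f => v; rewrite -eqFG. Qed.

Lemma computable_comp1 k (G : nat -> nat) (H : k.-tuple nat -> nat) :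
  computable (fun v : 1.-tuple nat => G (thead v)) -> computable H ->
  computable (fun v => G (H v)).
Proof.
move=> Gc Hc; have := computable_comp Gc (fun=> Hc).
by apply: eq_computable => v; rewrite /thead tnth_mktuple.
Qed.

Lemma computable_comp2 k (G : nat -> nat -> nat) (H1 H2 : k.-tuple nat -> nat) :
  computable (fun v : 2.-tuple nat => G (tnth v ord0) (tnth v ord_max)) ->
  computable H1 -> computable H2 -> computable (fun v => G (H1 v) (H2 v)).
Proof.
move=> Gc H1c H2c.
have Hc (i : 'I_2) : computable (if i == ord0 then H1 else H2) by case: ifP.
by have := computable_comp Gc Hc; apply: eq_computable => v; rewrite !tnth_mktuple.
Qed.

Lemma computable_succ k (H : k.-tuple nat -> nat) :
  computable H -> computable (fun v => (H v).+1).
Proof. by apply: computable_comp1; exists RSucc. Qed.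

Lemma computable_const k c : computable (fun _ : k.-tuple nat => c).
Proof.
elim: c => [|c IH]; first by exists (RZero k).
exact: computable_succ.
Qed.

(** The trace demanded by [RPrec] is the sequence of partial iterates. This scheme suffices for
    sums, triangular numbers and the codes of the expressions [elem_expr m]. *)
Lemma computable_iteri k (G : k.-tuple nat -> nat) (H : nat -> nat -> nat) :
  computable G ->
  computable (fun v : 2.-tuple nat => H (tnth v ord0) (tnth v ord_max)) ->
  computable (fun v : k.+1.-tuple nat =>
    iteri (thead v) H (G [tuple of behead v])).
Proof.
move=> [g gP] Hc.
have [h hP] : computable (fun v : k.+2.-tuple nat =>
    H (tnth v ord0) (tnth v (lift ord0 ord0))).
  by apply: computable_comp2 => //; apply: computable_proj.
exists (RPrec g h) => v.
exists (fun i => iteri i H (G [tuple of behead v])); by [].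
Qed.

Lemma computable_add k (H1 H2 : k.-tuple nat -> nat) :
  computable H1 -> computable H2 -> computable (fun v => H1 v + H2 v).
Proof.
apply: (computable_comp2 (G := addn)).
have := computable_iteri (H := fun _ s => s.+1) (@computable_proj 1 ord0)
  (computable_succ (@computable_proj 2 ord_max)).
apply: eq_computable => v; rewrite -[tnth v ord0]/(thead v).
case/tupleP: v => n v; rewrite theadE (tnth_nth 0) /= (tnth_nth 0) /=.
by elim: n => //= n ->.
Qed.

Lemma computable_npair k (H1 H2 : k.-tuple nat -> nat) :
  computable H1 -> computable H2 -> computable (fun v => npair (H1 v) (H2 v)).
Proof.
move=> H1c H2c.
have step : computable (fun v : 2.-tuple nat => tnth v ord_max + (tnth v ord0).+1).
  apply: computable_add; first exact: computable_proj.
  by apply: computable_succ; apply: computable_proj.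
have tri : computable (fun v : 1.-tuple nat => 'C((thead v).+1, 2)).
  have := computable_iteri (H := fun i s => s + i.+1) (computable_const 0 0) step.
  apply: eq_computable => v; elim: (thead v) => //= n ->.
  by rewrite [RHS]binS bin1 addnC.
apply: computable_add => //; apply: (computable_comp1 (G := fun n =>
  'C(n.+1, 2))) => //.
by apply: computable_add.
Qed.

(** * Recursive functions in ordered databases *)

Section Models.
Variable A : choiceType.
Variables (U : {fset A}) (lt : rel A) (X : rel A -> Prop).

Definition zero a : Prop := ~ exists2 b, b \in U & lt b a.

Definition next a b : Prop :=
  lt a b /\ ~ exists2 d, d \in U & lt a d /\ lt d b.

(* The relations in [X] are the sequences available as witnesses of primitive
   recursions. They need not be functional: any two values at consecutive
   arguments are required to match. *)
Fixpoint sat k (f : recfun k) : k.-tuple A -> A -> Prop :=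
  match f in recfun k return k.-tuple A -> A -> Prop with
  | RZero _ => fun _ b => zero b
  | RSucc => fun v b => next (thead v) b
  | RProj _ i => fun v b => tnth v i = b
  | RComp _ m g h => fun v b =>
      exists w : m.-tuple A, (forall i, tnth w i \in U) /\
        ((forall i, sat (h i) v (tnth w i)) /\ sat g w b)
  | RPrec _ g h => fun v b =>
      exists r, X r /\
      [/\ forall i, i \in U -> zero i -> forall a, a \in U -> r i a ->
            sat g [tuple of behead v] a,
          forall i, i \in U -> lt i (thead v) \/ i = thead v ->
            exists2 a, a \in U & r i a,
          forall i, i \in U -> lt i (thead v) ->
            forall j, j \in U -> next i j ->
            forall a, a \in U -> r i a -> forall d, d \in U -> r j d ->
            sat h [tuple of i :: a :: behead v] d
        & r (thead v) b]
  | RMin _ g => fun v b =>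
      (exists2 a, a \in U & zero a /\ sat g [tuple of b :: v] a) /\
      forall i, i \in U -> lt i b ->
        exists2 a, a \in U & ~ zero a /\ sat g [tuple of i :: v] a
  end.

Definition linear : Prop :=
  [/\ forall a, a \in U -> ~~ lt a a,
      forall a, a \in U -> forall b, b \in U -> forall d, d \in U ->
        lt a b -> lt b d -> lt a d
    & forall a, a \in U -> forall b, b \in U -> a = b \/ lt a b \/ lt b a].

Fixpoint nth_element m a : Prop :=
  if m is m'.+1 then exists2 b, b \in U & nth_element m' b /\ next b a
  else zero a.

Section Linear.
Hypothesis lin : linear.

(** The number that [a] stands for: [rank] is an isomorphism from the finite linear order onto an
    initial segment of the natural numbers. *)
Definition rank a : nat := #|` [fset b in U | lt b a]|.

Lemma rank_mono a b : a \in U -> b \in U -> lt a b = (rank a < rank b).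
Proof.
have [irr tr tot] := lin.
have mono c d : c \in U -> d \in U -> lt c d -> rank c < rank d.
  move=> Uc Ud lt_cd; apply: fproper_ltn_card; rewrite fproperE.
  apply/andP; split; last apply/negP=> /fsubsetP/(_ c).
    by apply/fsubsetP=> e; rewrite !inE => /andP[Ue ?]; rewrite Ue (tr e Ue c).
  by rewrite !inE Uc lt_cd (negPf (irr c Uc)) => /(_ isT).
move=> Ua Ub; apply/idP/idP=> [|lt_r]; first exact: mono.
have [eq_ab|[//|/mono lt_ba]] := tot a Ua b Ub; first by rewrite eq_ab ltnn in lt_r.
by have := ltn_trans lt_r (lt_ba Ub Ua); rewrite ltnn.
Qed.

Lemma rank_inj a b : a \in U -> b \in U -> rank a = rank b -> a = b.
Proof.
have [_ _ tot] := lin => Ua Ub eq_r.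
by have [//|[]] := tot a Ua b Ub; rewrite rank_mono // eq_r ltnn.
Qed.

(** Pigeonhole: the predecessors of [a] are [rank a] in number and have distinct ranks below
    [rank a], so these ranks exhaust that interval. *)
Lemma rank_onto a n : a \in U -> n <= rank a -> exists2 b, b \in U & rank b = n.
Proof.
move=> Ua; rewrite leq_eqVlt => /predU1P[->|lt_n]; first by exists a.
set D := [fset b in U | lt b a].
have DP b : b \in D -> b \in U /\ rank b < rank a.
  by rewrite !inE => /andP[Ub]; rewrite rank_mono.
have uniq_r : uniq (map rank D).
  by rewrite map_inj_in_uniq // => b d /DP[Ub _] /DP[Ud _]; apply: rank_inj.
have sub_r : {subset map rank D <= iota 0 (rank a)}.
  by move=> _ /mapP[b /DP[_ lt_b] ->]; rewrite mem_iota.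
have [|_ eq_r] := uniq_min_size uniq_r sub_r; first by rewrite size_map size_iota.
have : n \in iota 0 (rank a) by rewrite mem_iota.
by rewrite -eq_r => /mapP[b /DP[Ub _] ->]; exists b.
Qed.

Lemma zeroP a : a \in U -> zero a <-> rank a = 0.
Proof.
move=> Ua; split=> [z|r0 [b Ub]]; last by rewrite rank_mono // r0.
apply/eqP; rewrite -leqn0 leqNgt; apply/negP=> r_gt0; case: z.
have [b Ub rb] := rank_onto Ua (ltnW r_gt0).
by exists b; rewrite // rank_mono ?rb.
Qed.

Lemma nextP a b : a \in U -> b \in U -> next a b <-> rank b = (rank a).+1.
Proof.
move=> Ua Ub; split=> [[lt_ab nd]|eq_r].
  apply/eqP; rewrite eqn_leq -rank_mono // lt_ab andbT leqNgt.
  apply/negP=> lt_r; case: nd.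
  have [d Ud rd] := rank_onto Ub (ltnW lt_r).
  by exists d; rewrite // !rank_mono // rd.
split=> [|[d Ud]]; rewrite !rank_mono ?eq_r //.
by case=> lt_ad; rewrite ltnS leqNgt lt_ad.
Qed.

(** Finitely many choices need no axiom. This turns a witness relation, which may be multivalued,
    into the function [s] required by the semantics of [RPrec]. *)
Lemma finite_choice (P : nat -> nat -> Prop) n :
  (forall i, i < n -> exists m, P i m) ->
  exists s : nat -> nat, forall i, i < n -> P i (s i).
Proof.
elim: n => [|n IH] exP; first by exists id.
have [i lt_i|s sP] := IH; first by apply: exP; apply: ltnW.
have [m Pm] := exP n (ltnSn n).
exists (fun i => if i == n then m else s i) => i.
by case: eqP => [->|/eqP ne_i] // lt_i; apply: sP; rewrite ltn_neqAle ne_i.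
Qed.

Lemma revalto_val k (f : recfun k) (v w : k.-tuple nat) y :
  v = w :> seq nat -> revalto f v y -> revalto f w y.
Proof. by move/val_inj->. Qed.

(** Holds for an arbitrary family [X]: the clause of a primitive recursion checks all values of [r]
    at consecutive arguments, so any selection of values is a genuine trace. The finiteness of the
    order does no harm, since [zero] and [next] are exact on ranks. *)
Theorem sat_sound k (f : recfun k) v b :
  (forall i, tnth v i \in U) -> b \in U -> sat f v b ->
  revalto f [tuple of map rank v] (rank b).
Proof.
have consU m a (u : m.-tuple A) : a \in U -> (forall i, tnth u i \in U) ->
    forall i, tnth [tuple of a :: u] i \in U.
  move=> Ua Uu i; case: (unliftP ord0 i) => [j ->|->]; last by rewrite tnth0.
  by rewrite tnthS.
elim: f v b => {k} [k||k i|k m g IHg h IHh|k g IHg h IHh|k g IHg] v b Uv Ub /=.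
- by move/zeroP->.
- by case/tupleP: v Uv => a v Uv; move/nextP->; rewrite ?theadE //;
  exact: (Uv ord0).
- by move=> <-; rewrite tnth_map.
- case=> w [Uw [hw gw]]; exists [tuple of map rank w]; split; last exact: IHg.
  by move=> i; rewrite tnth_map; apply: IHh.
- case/tupleP: v Uv => n v Uvn; have Un := Uvn ord0.
  have Uv i : tnth v i \in U by have := Uvn (lift ord0 i); rewrite tnthS.
  rewrite tnth0 in Un; rewrite !theadE.
  have -> : [tuple of behead [tuple of n :: v]] = v by apply: val_inj.
  have -> : [tuple of behead [tuple of map rank [tuple of n :: v]]] =
    [tuple of map rank v] by apply: val_inj.
  rewrite [thead _](_ : _ = rank n) //.
  case=> r [_ [r0 rT rS rb]].
  (* [m] is the rank of some value of [r] at the element of rank [i]. As [r] may be multivalued, the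
     last clause forces the selected value at [n] to be [b]. *)
  pose P i m := exists2 u, u \in U & exists2 a, a \in U &
    [/\ rank u = i, r u a, rank a = m & i = rank n -> a = b].
  have [i|s sP] := @finite_choice P (rank n).+1.
    rewrite ltnS leq_eqVlt => /predU1P[->|lt_i].
      by exists (rank b), n => //; exists b.
    have [u Uu ru] := rank_onto Un (ltnW lt_i).
    have [|a Ua ra] := rT u Uu; first by left; rewrite rank_mono ?ru.
    exists (rank a), u => //; exists a => //; split=> // eq_i.
    by rewrite eq_i ltnn in lt_i.
  exists s; split=> [|i lt_i|].
  + have [u Uu [a Ua [ru rua <- _]]] := sP 0 isT.
    by apply: IHg => //; apply: (r0 u) => //; apply/zeroP.
  + have [u Uu [a Ua [ru rua ra _]]] := sP i (ltnW lt_i).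
    have [u' Uu' [a' Ua' [ru' rua' <- _]]] := sP i.+1 lt_i.
    have U2 := consU _ _ _ Uu (consU _ _ _ Ua Uv).
    apply: (revalto_val _ (IHh _ _ U2 Ua' _)); first by rewrite /= ru ra.
    have nuu' : next u u' by apply/nextP; rewrite ?ru.
    have lt_u : lt u n by rewrite rank_mono ?ru.
    have := rS u Uu lt_u u' Uu' nuu' a Ua rua a' Ua' rua'.
    by congr sat; apply: val_inj.
  + by have [u _ [a _ [_ _ <- ->]]] := sP (rank n) (ltnSn _).
- case=> -[a Ua [za ga]] gi; split=> [|i lt_i].
    rewrite -(zeroP Ua).1 //.
    by apply: revalto_val (IHg _ _ (consU _ _ _ Ub Uv) Ua ga).
  have [u Uu ru] := rank_onto Ub (ltnW lt_i).
  have [|d Ud [nzd gd]] := gi u Uu; first by rewrite rank_mono ?ru.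
  have : rank d != 0 by apply/eqP=> /(zeroP Ud).
  case E: (rank d) => [//|z] _; exists z; rewrite -E.
  by apply: revalto_val (IHg _ _ (consU _ _ _ Uu Uv) Ud gd); rewrite /= ru.
Qed.

Lemma rank_nth_element m a : a \in U -> nth_element m a -> rank a = m.
Proof.
elim: m a => [|m IH] a Ua /=; first by move/zeroP->.
by case=> b Ub [/(IH _ Ub) <- /nextP->].
Qed.

End Linear.
End Models.

(** * Canonical databases and completeness *)

Section Canonical.
Variables (A : choiceType) (en : nat -> A).
Hypothesis en_inj : injective en.

(* The atom [en i] plays the part of [i]; [X] may contain any further
   relations. *)
Definition canonical_model N (D : seq (seq nat)) (U : {fset A}) (lt : rel A)
    (X : rel A -> Prop) : Prop :=
  [/\ U = [fset en i | i in iota 0 N],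
      forall i j, i < N -> j < N -> lt (en i) (en j) = (i < j)
    & forall s, s \in D -> exists r, X r /\
        forall i b, r (en i) b = (i < size s) && (b == en (nth 0 s i))].

(** Truth in all canonical databases that are long enough and contain the sequences of [D].
    Quantifying over all of them makes the notion closed under finite conjunctions, without any
    proof that satisfaction survives an enlargement of the database. *)
Definition eventually (P : {fset A} -> rel A -> (rel A -> Prop) -> Prop) :=
  exists N0 D, forall N U lt X,
    N0 <= N -> canonical_model N D U lt X -> P U lt X.

Lemma canonical_sub N D D' U lt X :
  {subset D' <= D} -> canonical_model N D U lt X -> canonical_model N D' U lt X.
Proof. by move=> sD [eU ltE XE]; split=> // s /sD; apply: XE. Qed.

Lemma eventually_and P Q : eventually P -> eventually Q ->
  eventually (fun U lt X => P U lt X /\ Q U lt X).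
Proof.
case=> N [D PD] [N' [D' QD']]; exists (maxn N N'), (D ++ D') => M U lt X.
rewrite geq_max => /andP[leN leN'] mod; split.
  by apply: PD leN _; apply: canonical_sub mod => s; rewrite mem_cat => ->.
apply: QD' leN' _; apply: canonical_sub mod => s.
by rewrite mem_cat orbC => ->.
Qed.

Lemma eventually_impl (P Q : _ -> _ -> _ -> Prop) :
  (forall U lt X, P U lt X -> Q U lt X) -> eventually P -> eventually Q.
Proof. by move=> PQ [N [D PD]]; exists N, D => *; apply/PQ/PD; eassumption. Qed.

Lemma eventually_all n (P : nat -> _ -> _ -> _ -> Prop) :
  (forall i, i < n -> eventually (P i)) ->
  eventually (fun U lt X => forall i, i < n -> P i U lt X).
Proof.
elim: n => [|n IH] evP; first by exists 0, [::].
have ev_n := IH (fun i lt_i => evP i (ltnW lt_i)).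
apply: eventually_impl (eventually_and ev_n (evP n (ltnSn n))) => U lt X.
by case=> Pi Pn i; rewrite ltnS leq_eqVlt => /predU1P[->|/Pi].
Qed.

(** Conjoined with other eventual properties, it puts a canonical model of guaranteed length at hand
    inside [eventually_impl]. *)
Lemma eventually_model N D :
  eventually (fun U lt X => exists2 M, N <= M & canonical_model M D U lt X).
Proof. by exists N, D => M *; exists M. Qed.

Section Elements.
Variables (N : nat) (D : seq (seq nat)) (U : {fset A}) (lt : rel A).
Variable X : rel A -> Prop.
Hypothesis mod : canonical_model N D U lt X.

Lemma canonical_mem a : a \in U <-> exists2 i, i < N & a = en i.
Proof.
case: mod => -> _ _; split=> [/imfsetP[i /= + ->]|[i lt_i ->]].
  by rewrite mem_iota; exists i.
by apply/imfsetP; exists i; rewrite //= mem_iota.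
Qed.

Lemma canonical_in i : i < N -> en i \in U.
Proof. by move=> lt_i; apply/canonical_mem; exists i. Qed.

Lemma canonical_lt i j : i < N -> j < N -> lt (en i) (en j) = (i < j).
Proof. by case: mod => _ + _; apply. Qed.

Lemma canonical_linear : linear U lt.
Proof.
split=> [_ /canonical_mem[i ltiN ->]|_ /canonical_mem[i ltiN ->]
  _ /canonical_mem[j ltjN ->]|_ /canonical_mem[i ltiN ->]
  _ /canonical_mem[j ltjN ->]].
- by rewrite canonical_lt // ltnn.
- move=> _ /canonical_mem[l ltlN ->]; rewrite !canonical_lt //.
  exact: ltn_trans.
- by rewrite !canonical_lt //; case: (ltngtP i j) => [||->]; auto.
Qed.

Lemma canonical_zero i : i < N -> zero U lt (en i) <-> i = 0.
Proof.
move=> lt_i; split=> [z|-> [_ /canonical_mem[j lt_j ->]]]; last first.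
  by rewrite canonical_lt // (leq_ltn_trans _ lt_i).
case: i lt_i z => // i lt_i []; have lt0 := leq_ltn_trans (leq0n _) lt_i.
by exists (en 0); [apply: canonical_in | rewrite canonical_lt].
Qed.

Lemma canonical_next i j : i < N -> j < N -> next U lt (en i) (en j) <-> j = i.+1.
Proof.
move=> lt_i lt_j; rewrite /next canonical_lt //; split=> [[ltij nd]|eq_j].
  apply/eqP; rewrite eqn_leq ltij andbT leqNgt; apply/negP=> ltij'.
  have lt_i' := ltn_trans ltij' lt_j.
  by case: nd; exists (en i.+1); rewrite ?canonical_in ?canonical_lt.
rewrite eq_j leqnn; split=> // -[_ /canonical_mem[d lt_d ->]].
by rewrite -eq_j !canonical_lt // eq_j => -[ltid]; rewrite ltnS leqNgt ltid.
Qed.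

Lemma canonical_nth_element m : m < N -> nth_element U lt m (en m).
Proof.
elim: m => [|m IH] lt_m /=; first exact/canonical_zero.
exists (en m); first by apply: canonical_in; apply: ltnW.
by split; [apply/IH/ltnW | apply/canonical_next => //; apply: ltnW].
Qed.

End Elements.

(** A terminating computation involves finitely many numbers and finitely many recursion traces; the
    induction on [f] collects a bound for the former and a list of the latter. *)
Theorem sat_complete k (f : recfun k) v y : revalto f v y ->
  eventually (fun U lt X => sat U lt X f [tuple of map en v] (en y)).
Proof.
elim: f v y => {k} [k||k i|k m g IHg h IHh|k g IHg h IHh|k g IHg] v y /=.
- move=> ->; apply: eventually_impl (eventually_model 1 [::]) => U lt X [N lt0 mod].
  by apply/(canonical_zero mod).
- case/tupleP: v => x v ->; rewrite theadE.
  apply: eventually_impl (eventually_model x.+2 [::]) => U lt X [N ltN mod].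
  by apply/(canonical_next mod); rewrite // ltnW.
- by move=> ->; exists 0, [::] => *; rewrite tnth_map.
- case=> w [hw gw].
  have evw : eventually (fun U lt X => forall i : 'I_m,
      sat U lt X (h i) [tuple of map en v] (en (tnth w i))).
    (* Indices in ['I_m] are traded for numbers below [m], over which [eventually_all] takes the
       conjunction. *)
    pose P j U lt X := forall i : 'I_m, i = j :> nat ->
      sat U lt X (h i) [tuple of map en v] (en (tnth w i)).
    apply: (@eventually_impl (fun U lt X => forall j, j < m -> P j U lt X)) =>
      [U lt X Pm i|].
      exact: Pm (ltn_ord i) i erefl.
    apply: eventually_all => j lt_j.
    apply: eventually_impl (IHh (Ordinal lt_j) _ _ (hw _)) => U lt X sj i eq_i.
    by rewrite (_ : i = Ordinal lt_j) //; apply: val_inj.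
  (* All intermediate values [tnth w i] must be represented in the universe. *)
  have evN := eventually_model (\max_(i < m) (tnth w i).+1) [::].
  apply: eventually_impl (eventually_and evN (eventually_and evw (IHg _ _ gw))).
  move=> U lt X [[N leN mod] [hU gU]]; exists [tuple of map en w].
  split=> [i|]; last by split=> // i; rewrite tnth_map.
  rewrite tnth_map; apply: canonical_in mod _ _.
  by apply: leq_trans leN; apply: (leq_bigmax_cond (F := fun i => (tnth w i).+1)).
- case/tupleP: v => n v [s []]; rewrite [thead _](_ : _ = n) //.
  have -> : [tuple of behead [tuple of n :: v]] = v by apply: val_inj.
  move=> gs hs ->.
  have evh : eventually (fun U lt X => forall i, i < n ->
      sat U lt X h [tuple of map en [tuple of i :: [tuple of s i :: v]]]
        (en (s i.+1))).
    apply: eventually_all => i lt_i; apply: IHh.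
    by have := hs i lt_i; congr revalto; apply: val_inj.
  (* The sum exceeds both the arguments [0..n] and the values of [s] at them; the trace of the
     recursion is put into the database as a sequence of length [n.+1]. *)
  have evN := eventually_model (n.+1 + \max_(i < n.+1) (s i).+1) [:: mkseq s n.+1].
  apply: eventually_impl (eventually_and evN (eventually_and evh (IHg _ _ gs))).
  move=> U lt X [[N leN mod] [hU gU]].
  have lt_nN : n < N by apply: leq_trans leN; apply: leq_addr.
  have lt_sN i : i <= n -> s i < N.
    rewrite -ltnS => lt_i; apply: leq_trans leN;
      rewrite -[X in X <= _]add0n leq_add //.
    exact: (leq_bigmax_cond (F := fun i : 'I_n.+1 => (s i).+1) (Ordinal lt_i)).
  have [_ _ /(_ _ (mem_head _ _))[r [Xr rE]]] := mod.
  have {}rE i b : i <= n -> r (en i) b = (b == en (s i)).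
    by move=> le_i; rewrite rE size_mkseq ltnS le_i nth_mkseq.
  exists r; split=> //.
  have -> : [tuple of behead [tuple of map en [tuple of n :: v]]] =
    [tuple of map en v] by apply: val_inj.
  rewrite [thead _](_ : _ = en n) //; split.
  + move=> _ /(canonical_mem mod)[i lt_i ->] /(canonical_zero mod lt_i)-> a _.
    by rewrite rE // => /eqP->.
  + move=> _ /(canonical_mem mod)[i lt_i ->] lt_in.
    have le_i : i <= n.
      by case: lt_in => [|/en_inj->] //; rewrite (canonical_lt mod) // => /ltnW.
    exists (en (s i)); last by rewrite rE.
    exact: canonical_in mod _ (lt_sN i le_i).
  + move=> _ /(canonical_mem mod)[i lt_i ->]; rewrite (canonical_lt mod) // =>
    lt_in.
    move=> _ /(canonical_mem mod)[j lt_j ->] /(canonical_next mod lt_i lt_j) eq_j.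
    move=> a _; rewrite rE ?(ltnW lt_in) // => /eqP-> d _.
    rewrite eq_j rE // => /eqP->.
    by have := hU i lt_in; congr sat; apply: val_inj.
  + by rewrite rE.
- case=> gy gi.
  have evi : eventually (fun U lt X => forall i, i < y -> exists2 a, a \in U &
      ~ zero U lt a /\ sat U lt X g [tuple of map en [tuple of i :: v]] a).
    apply: eventually_all => i /gi[z gz].
    have evz := eventually_model z.+2 [::].
    apply: eventually_impl (eventually_and evz (IHg _ _ gz)).
    move=> U lt X [[N ltN mod] gU]; exists (en z.+1);
      first exact: canonical_in mod _ _.
    by split=> //; move/(canonical_zero mod ltN).
  have evy := eventually_model y.+1 [::].
  apply: eventually_impl (eventually_and evy (eventually_and evi (IHg _ _ gy))).
  move=> U lt X [[N ltN mod] [iU gU]]; have N0 : 0 < N by apply: leq_ltn_trans ltN.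
  split.
    exists (en 0); first exact: canonical_in mod _ _.
    split; first exact/(canonical_zero mod).
    by move: gU; congr sat; apply: val_inj.
  move=> _ /(canonical_mem mod)[i lt_i ->]; rewrite (canonical_lt mod) // => lt_iy.
  have [a Ua [nza ga]] := iU i lt_iy; exists a => //; split=> //.
  by move: ga; congr sat; apply: val_inj.
Qed.

End Canonical.

(** * First-order formulas as expressions *)

Lemma enum_fset_one (K : choiceType) (k : K) : enum_fset [fset k] = [:: k].
Proof.
apply: perm_small_eq => //; apply: uniq_perm; rewrite ?fset_uniq // => x.
by rewrite -[LHS]/(x \in [fset k]) !inE.
Qed.

(* The variables of the database are 0 (the atom c), 1 (the universe), 2 (the
   order, as a set of elements labelled i with data nodes j, for i < j) and 3
   (the sequences). The argument [n] of a formula exceeds all its free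
   variables: bound variables are de Bruijn levels. A formula returns
   {<c:{}>} when true and the empty value when false. *)
Definition form := nat -> expr.
Implicit Types (p q : form).

Definition fTrue : form := fun=> EElem (EVar 0) EEmpty.
(* The name of [p n] is c if [p] is true, and concat(()) if it is false. *)
Definition fNot p : form := fun n =>
  EIf (EName (p n)) (EName EEmpty) (fTrue n) EEmpty.
Definition fOr p q : form := fun n => EConcat (p n) (q n).
Definition fAnd p q : form := fNot (fOr (fNot p) (fNot q)).
Definition fImp p q : form := fOr (fNot p) q.
Definition fEq e1 e2 : form := fun n => EIf e1 e2 (fTrue n) EEmpty.
(** A [for] loop takes the union of the truth values of its body, which is their disjunction. *)
Definition fEx e (F : nat -> form) : form := fun n => EFor n e (F n n.+1).
Definition fAll e (F : nat -> form) : form := fNot (fEx e (fun x => fNot (F x))).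
(** [eq] compares data, so the child [j], a data node, can be compared directly with the atom in
    [y]. *)
Definition fRel e x y : form :=
  fEx e (fun i => fEx (EChildren (EVar i)) (fun j =>
    fAnd (fEq (EName (EVar i)) (EVar x)) (fEq (EVar j) (EVar y)))).
Definition fLt x y : form := fRel (EVar 2) x y.
Definition fZero x : form := fNot (fEx (EVar 1) (fun y => fLt y x)).
Definition fNext x y : form :=
  fAnd (fLt x y) (fNot (fEx (EVar 1) (fun z => fAnd (fLt x z) (fLt z y)))).

Fixpoint fExs m : (m.-tuple nat -> form) -> form :=
  match m return (m.-tuple nat -> form) -> form with
  | 0 => fun F => F [tuple]
  | m'.+1 => fun F => fEx (EVar 1) (fun x => fExs (fun w => F [tuple of x :: w]))
  end.

Definition fAlls m (F : 'I_m -> form) : form :=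
  foldr (fun i => fAnd (F i)) fTrue (enum 'I_m).

(** Follows [sat] clause by clause. In a primitive recursion the bound variable [s] ranges over the
    elements in variable 3, and the relation [r] is read off the children of [s]. *)
Fixpoint fSat k (f : recfun k) : k.-tuple nat -> nat -> form :=
  match f in recfun k return k.-tuple nat -> nat -> form with
  | RZero _ => fun _ y => fZero y
  | RSucc => fun v y => fNext (thead v) y
  | RProj _ i => fun v y => fEq (EVar (tnth v i)) (EVar y)
  | RComp _ m g h => fun v y =>
      fExs (fun w => fAnd (fAlls (fun i => fSat (h i) v (tnth w i))) (fSat g w y))
  | RPrec _ g h => fun v y =>
      fEx (EVar 3) (fun s => let r := fRel (EChildren (EVar s)) in
        fAnd
          (fAnd
            (fAll (EVar 1) (fun i => fImp (fZero i)
              (fAll (EVar 1) (fun a => fImp (r i a)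
                (fSat g [tuple of behead v] a)))))
            (fAll (EVar 1) (fun i => fImp
              (fOr (fLt i (thead v)) (fEq (EVar i) (EVar (thead v))))
              (fEx (EVar 1) (fun a => r i a)))))
          (fAnd
            (fAll (EVar 1) (fun i => fImp (fLt i (thead v))
              (fAll (EVar 1) (fun j => fImp (fNext i j)
                (fAll (EVar 1) (fun a => fImp (r i a)
                  (fAll (EVar 1) (fun d => fImp (r j d)
                    (fSat h [tuple of i :: a :: behead v] d)))))))))
            (r (thead v) y)))
  | RMin _ g => fun v y =>
      fAnd
        (fEx (EVar 1) (fun a => fAnd (fZero a) (fSat g [tuple of y :: v] a)))
        (fAll (EVar 1) (fun i => fImp (fLt i y)
          (fEx (EVar 1) (fun a => fAnd (fNot (fZero a))
            (fSat g [tuple of i :: v] a)))))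
  end.

Definition fLinear : form :=
  fAnd (fAll (EVar 1) (fun x => fNot (fLt x x)))
  (fAnd
    (fAll (EVar 1) (fun x => fAll (EVar 1) (fun y => fAll (EVar 1) (fun z =>
      fImp (fLt x y) (fImp (fLt y z) (fLt x z))))))
    (fAll (EVar 1) (fun x => fAll (EVar 1) (fun y =>
      fOr (fEq (EVar x) (EVar y)) (fOr (fLt x y) (fLt y x)))))).

(** * Values of the formulas in an environment *)

Section Evaluation.
Variables (A : choiceType).
Variables (content : A -> {fset node A} -> A) (concat : {fset A} -> A).
Variables (c : A) (U : {fset A}) (L V : value A).
Hypothesis c_neq : c != concat fset0.

Notation ev := (eval content concat).

(** The shape secured by the input types, under which [fRel] is defined and reads [v] as a binary
    relation. *)
Definition pairs (v : value A) : Prop := forall i, i \in v ->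
  exists a N, i = inr (elem_node a N) /\ forall m, m \in N -> exists b,
    m = data_node b.

Definition rel_of (v : value A) : rel A := fun a b =>
  has (fun i : item A => if i is inr m then
                if node_view m is inr (a', N) then (a' == a) && (data_node b \in N)
                else false
              else false) v.

Definition rels (r : rel A) : Prop :=
  exists a N, inr (elem_node a N) \in V /\ r = rel_of [fset inr m | m in N].

Hypothesis pairsL : pairs L.
Hypothesis pairsV : forall i, i \in V -> exists a N,
  i = inr (elem_node a N) /\ pairs [fset inr m | m in N].

Definition truth : value A := [fset inr (elem_node c fset0)].

(** Records at once that the expression is defined, that its value is the truth value of [P], and
    that [P] is decided, so that classical laws such as De Morgan's are available constructively. *)
Definition dec e sigma P : Prop :=
  (P /\ ev e sigma = Some truth) \/ (~ P /\ ev e sigma = Some fset0).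

(** [4 <= n] protects the database: binders at level [n] or above cannot shadow the variables 0 to
    3. *)
Definition base n (sigma : env A) : Prop :=
  [/\ 4 <= n, sigma.[? 0] = Some [fset inl c],
     sigma.[? 1] = Some [fset inl a | a in U],
     sigma.[? 2] = Some L & sigma.[? 3] = Some V].

Definition atom_at n (sigma : env A) x a : Prop :=
  x < n /\ sigma.[? x] = Some [fset inl a].

Lemma base_set n sigma v : base n sigma -> base n.+1 sigma.[n <- v].
Proof.
case=> le4n s0 s1 s2 s3.
have neq x : x < 4 -> (x == n) = false.
  by move=> lt_x; rewrite ltn_eqF // (leq_trans lt_x).
by split; rewrite ?(leqW le4n) // fnd_set neq.
Qed.

Lemma atom_at_set n sigma x a v :
  atom_at n sigma x a -> atom_at n.+1 sigma.[n <- v] x a.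
Proof. by case=> lt_x sx; split;
  rewrite ?(ltnW lt_x) ?fnd_set ?ltn_eqF // leqW. Qed.

Lemma atom_at_new n sigma a : atom_at n.+1 sigma.[n <- [fset inl a]] n a.
Proof. by split; rewrite ?fnd_set ?eqxx. Qed.

Lemma dec_iff e sigma P Q : P <-> Q -> dec e sigma P -> dec e sigma Q.
Proof. by move=> PQ [[/PQ]|[nP]]; [left | right; split=> // /PQ]. Qed.

Lemma dec_true n sigma P : P -> base n sigma -> dec (fTrue n) sigma P.
Proof.
move=> HP [_ s0 _ _ _]; left; split=> //=; rewrite s0 /construct /data.
by rewrite imfset_fset1 /fset_the enum_fset_one /= imfset0.
Qed.

Lemma data_one i : data content [fset i] = [fset item_data content i].
Proof. exact: imfset_fset1. Qed.

Lemma fset_the_one (K : choiceType) (k : K) : fset_the [fset k] = Some k.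
Proof. by rewrite /fset_the enum_fset_one. Qed.

Lemma dec_eq n sigma e1 e2 i j : base n sigma -> ev e1 sigma = Some [fset i] ->
  ev e2 sigma = Some [fset j] ->
  dec (fEq e1 e2 n) sigma (item_data content i = item_data content j).
Proof.
move=> bs /= ev1 ev2; rewrite /dec -/(fTrue n) /= ev1 ev2 !data_one !fset_the_one.
case: eqP => [eq_ij|]; last by right.
by case: (dec_true eq_ij bs) => [[]|[]]; left.
Qed.

Lemma dec_atom_eq n sigma x y a b : base n sigma ->
  atom_at n sigma x a -> atom_at n sigma y b ->
  dec (fEq (EVar x) (EVar y) n) sigma (a = b).
Proof. by move=> bs [_ sx] [_ sy]; apply: (dec_eq (i := inl a) (j := inl b)). Qed.

Lemma dec_not p n sigma P : base n sigma -> dec (p n) sigma P ->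
  dec (fNot p n) sigma (~ P).
Proof.
move=> bs dP; have dt := dec_true (n := n) (P := ~ P) (sigma := sigma) _ bs.
have nmT : name concat truth = Some [fset inl c].
  by rewrite /name enum_fset_one node_view_elem.
case: dP => [[HP eP]|[nP eP]]; rewrite /dec /= eP /= ?nmT !data_one !fset_the_one.
  by rewrite (negPf c_neq); right; split=> // /(_ HP).
by rewrite eqxx; case: (dt nP) => [[]|[]]; left.
Qed.

Lemma dec_or p q n sigma P Q : dec (p n) sigma P -> dec (q n) sigma Q ->
  dec (fOr p q n) sigma (P \/ Q).
Proof.
by rewrite /dec /= => -[[HP ->]|[nP ->]] [[HQ ->]|[nQ ->]];
  rewrite ?fsetUid ?fsetU0 ?fset0U; [left|left|left|right]; split; intuition.
Qed.

Lemma dec_and p q n sigma P Q : base n sigma ->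
  dec (p n) sigma P -> dec (q n) sigma Q -> dec (fAnd p q n) sigma (P /\ Q).
Proof.
move=> bs dP dQ;
  apply: dec_iff (dec_not bs (dec_or (dec_not bs dP) (dec_not bs dQ))).
by case: dP dQ => [[HP _]|[nP _]] [[HQ _]|[nQ _]]; split; intuition.
Qed.

Lemma dec_imp p q n sigma P Q : base n sigma ->
  dec (p n) sigma P -> dec (q n) sigma Q -> dec (fImp p q n) sigma (P -> Q).
Proof.
move=> bs dP dQ; apply: dec_iff (dec_or (dec_not bs dP) dQ).
by case: dP => [[HP _]|[nP _]]; split; intuition.
Qed.

Lemma union_overE (v : value A) F (G : item A -> value A) :
  (forall i, i \in v -> F i = Some (G i)) ->
  union_over v F = Some (\bigcup_(i <- v) G i).
Proof.
move=> FG; rewrite /union_over ifT.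
  by congr Some; apply: eq_big_seq => i /FG->.
by apply/allP=> i /FG->.
Qed.

(** The existential is decided by a boolean search, through the finite set [W], for an item at which
    the body evaluates to [truth]. *)
Lemma dec_ex e (F : nat -> form) n sigma W P : ev e sigma = Some W ->
  (forall i, i \in W -> dec (F n n.+1) sigma.[n <- [fset i]] (P i)) ->
  dec (fEx e F n) sigma (exists2 i, i \in W & P i).
Proof.
move=> eW dP; rewrite /dec /= eW; set G := fun i =>
  odflt fset0 (ev (F n n.+1) sigma.[n <- [fset i]]).
rewrite (@union_overE _ _ G); last first.
  by move=> i /dP; rewrite /G => -[[_ ->]|[_ ->]].
have GP i : i \in W -> (P i /\ G i = truth) \/ (~ P i /\ G i = fset0).
  by move=> /dP; rewrite /G => -[[Pi ->]|[nPi ->]]; [left | right].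
have sub i : i \in W -> G i `<=` truth.
  by case/GP=> -[_ ->].
case: (boolP (has (fun i => G i == truth) W)) => [/hasP[i Wi /eqP Gi]|/hasPn nG].
  left; split.
    exists i => //; case: (GP i Wi) => -[] // _; rewrite Gi =>
      /fsetP/(_ (inr (elem_node c fset0))).
    by rewrite !inE eqxx.
  congr Some; apply/fsetP=> t; apply/bigfcupP/idP=> [[j /andP[Wj _] tj]|tt].
    exact: (fsubsetP (sub j Wj)).
  by exists i; rewrite ?Wi // Gi.
right; split=> [[i Wi Pi]|].
  by case: (GP i Wi) => -[] // _ Gi; have := nG i Wi; rewrite Gi eqxx.
congr Some; apply/fsetP=> t; rewrite in_fset0;
  apply/negP=> /bigfcupP[j /andP[Wj _]].
by have [[_ Gj]|[_ ->] //] := GP j Wj; have := nG j Wj; rewrite Gj eqxx.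
Qed.

Lemma dec_exU (F : nat -> form) n sigma P : base n sigma ->
  (forall a, a \in U -> dec (F n n.+1) sigma.[n <- [fset inl a]] (P a)) ->
  dec (fEx (EVar 1) F n) sigma (exists2 a, a \in U & P a).
Proof.
move=> [_ _ s1 _ _] dP.
(* The value on nodes is a dummy: the universe contains atoms only. *)
pose Q (i : item A) := if i is inl a then P a else True.
apply: (@dec_iff _ _ (exists2 i, i \in [fset inl a | a in U] & Q i)).
  split=> [[_ /imfsetP[a /= Ua ->]]|[a Ua Pa]]; first by exists a.
  by exists (inl a) => //; apply/imfsetP; exists a.
apply: dec_ex => //.
by move=> _ /imfsetP[a /= Ua ->]; apply: dP.
Qed.

Lemma dec_allU F n sigma P : base n sigma ->
  (forall a, a \in U -> dec (F n n.+1) sigma.[n <- [fset inl a]] (P a)) ->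
  dec (fAll (EVar 1) F n) sigma (forall a, a \in U -> P a).
Proof.
move=> bs dP; have dn a (Ua : a \in U) :=
  dec_not (base_set [fset inl a] bs) (dP a Ua).
apply: dec_iff (dec_not bs (dec_exU (F := fun x => fNot (F x)) bs dn)).
split=> [nex i Wi|allP [i Wi]]; last by apply; apply: allP.
by case: (dP i Wi) => [[]|[nPi _]] //; case: nex; exists i.
Qed.

Lemma eval_children_of n sigma a N :
  ev (EChildren (EVar n)) sigma.[n <- [fset inr (elem_node a N)]] =
  Some [fset inr m | m in N].
Proof.
rewrite /= fnd_set eqxx /= /children (@union_overE _ _ (fun=> [fset inr m | m in N])).
  by rewrite big_seq_fset1.
by move=> i; rewrite inE => /eqP->; rewrite /= /node_children node_view_elem.
Qed.

Lemma dec_rel e n sigma W x y a b : base n sigma -> ev e sigma = Some W ->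
  pairs W -> atom_at n sigma x a -> atom_at n sigma y b ->
  dec (fRel e x y n) sigma (rel_of W a b).
Proof.
move=> bs eW pW xa yb.
(* What the inner loop decides for the item [i]. The default cases do not occur, since by [pairs W]
   every [i] is an element node. *)
pose P (i : item A) := exists2 j, j \in odflt fset0 (item_children i) &
  (if i is inr m then
     if node_view m is inr (a', _) then a' = a else False
   else False)
  /\ item_data content j = b.
apply: (@dec_iff _ _ (exists2 i, i \in W & P i)).
  split=> [[i Wi]|/hasP[i Wi]].
    case: (pW i Wi) => a' [N [eq_i dN]]; rewrite eq_i in Wi *.
    case=> j /=; rewrite /node_children node_view_elem => /imfsetP[m /= Nm ->] [<-].
    have [d eq_m] := dN m Nm; rewrite eq_m /= => <-.
    by apply/hasP; exists (inr (elem_node a' N));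
      rewrite ?node_view_elem ?eqxx -?eq_m.
  case: (pW i Wi) => a' [N [eq_i dN]]; rewrite eq_i node_view_elem in Wi * =>
    /andP[/eqP eq_a Nb].
  exists (inr (elem_node a' N)) => //; exists (inr (data_node b)).
    by rewrite /= /node_children node_view_elem; apply/imfsetP;
      exists (data_node b).
  by rewrite node_view_elem.
apply: dec_ex => // i Wi; case: (pW i Wi) => a' [N [-> dN]].
set s1 := sigma.[_ <- _].
have bs1 : base n.+1 s1 by apply: base_set.
rewrite /P /= /node_children node_view_elem; apply: dec_ex.
  exact: eval_children_of.
move=> j Nj; have bs2 : base n.+2 s1.[n.+1 <- [fset j]] by apply: base_set.
  apply: dec_and => //.
    apply: (@dec_eq _ _ _ _ (inl a') (inl a) bs2).
      rewrite /= !fnd_set eqxx ltn_eqF //= /name enum_fset_one node_view_elem //.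
    by case: (atom_at_set [fset j] (atom_at_set [fset inr (elem_node a' N)] xa)).
  apply: (@dec_eq _ _ _ _ j (inl b) bs2); first by rewrite /= fnd_set eqxx.
  by case: (atom_at_set [fset j] (atom_at_set [fset inr (elem_node a' N)] yb)).
Qed.

Notation lt := (rel_of L).

Lemma dec_lt n sigma x y a b : base n sigma ->
  atom_at n sigma x a -> atom_at n sigma y b ->
  dec (fLt x y n) sigma (lt a b).
Proof. by move=> bs; apply: dec_rel => //; case: bs. Qed.

Lemma dec_zero n sigma x a : base n sigma -> atom_at n sigma x a ->
  dec (fZero x n) sigma (zero U lt a).
Proof.
move=> bs xa; apply: dec_not => //; apply: dec_exU => // b Ub.
apply: dec_lt; [exact: base_set | exact: atom_at_new | exact: atom_at_set].
Qed.

Lemma dec_next n sigma x y a b : base n sigma ->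
  atom_at n sigma x a -> atom_at n sigma y b ->
  dec (fNext x y n) sigma (next U lt a b).
Proof.
move=> bs xa yb; apply: dec_and => //; first exact: dec_lt.
apply: dec_not => //; apply: dec_exU => // d Ud.
have bs1 := base_set [fset inl d] bs.
have xa1 := atom_at_set [fset inl d] xa; have yb1 := atom_at_set [fset inl d] yb.
have zd1 := atom_at_new n sigma d.
by apply: dec_and => //; apply: dec_lt.
Qed.

#[local] Hint Resolve base_set atom_at_set atom_at_new : core.

Definition atoms_at n sigma m (xs : m.-tuple nat) (v : m.-tuple A) :=
  forall i, atom_at n sigma (tnth xs i) (tnth v i).

Lemma atoms_at_set n sigma m (xs : m.-tuple nat) v w :
  atoms_at n sigma xs v -> atoms_at n.+1 sigma.[n <- w] xs v.
Proof. by move=> xv i; apply: atom_at_set. Qed.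

Lemma atoms_at_cons n sigma m x a (xs : m.-tuple nat) v : atom_at n sigma x a ->
  atoms_at n sigma xs v -> atoms_at n sigma [tuple of x :: xs] [tuple of a :: v].
Proof.
move=> xa xv i; case: (unliftP ord0 i) => [j ->|->]; last by rewrite !tnth0.
by rewrite !tnthS.
Qed.

#[local] Hint Resolve atoms_at_set atoms_at_cons : core.

(** The induction binds the variables one at a time before [F] receives the whole tuple, so the
    premise is stated for every later level and environment that keeps the atoms bound so far. *)
Lemma dec_exs m : forall (F : m.-tuple nat -> form) n sigma
    (P : m.-tuple A -> Prop), base n sigma ->
  (forall n' sigma' xs v, n <= n' ->
    (forall x a, atom_at n sigma x a -> atom_at n' sigma' x a) ->
    base n' sigma' -> atoms_at n' sigma' xs v -> (forall i, tnth v i \in U) ->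
    dec (F xs n') sigma' (P v)) ->
  dec (fExs F n) sigma (exists v, (forall i, tnth v i \in U) /\ P v).
Proof.
elim: m => [|m IH] F n sigma P bs dP.
  apply: (@dec_iff _ _ (P [tuple])).
    split=> [Pv|[v [_ Pv]]]; last by rewrite (tuple0 v) in Pv.
    by exists [tuple]; split=> // -[].
  by apply: dP => //; case.
pose Q a :=
  exists w : m.-tuple A, (forall i, tnth w i \in U) /\ P [tuple of a :: w].
apply: (@dec_iff _ _ (exists2 a, a \in U & Q a)).
  split=> [[a Ua [w [Uw Pw]]]|[v [Uv Pv]]].
    exists [tuple of a :: w]; split=> // i.
    by case: (unliftP ord0 i) => [j ->|->]; rewrite ?tnth0 ?tnthS.
  case/tupleP: v Uv Pv => a w Uv Pv; exists a; first exact: (Uv ord0).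
  by exists w; split=> // i; have := Uv (lift ord0 i); rewrite tnthS.
apply: dec_exU => // a Ua; apply: IH => [|n' sigma' xs v le_n at' bs' xv Uv].
  exact: base_set.
apply: dP => // [|x b xb||i]; first exact: ltnW.
- by apply: at'; apply: atom_at_set.
- by apply: atoms_at_cons => //; apply: at'; apply: atom_at_new.
by case: (unliftP ord0 i) => [j ->|->]; rewrite ?tnth0 ?tnthS.
Qed.

Lemma dec_alls m (F : 'I_m -> form) n sigma P : base n sigma ->
  (forall i, dec (F i n) sigma (P i)) ->
  dec (fAlls F n) sigma (forall i, P i).
Proof.
move=> bs dP; apply: (@dec_iff _ _ (forall i, i \in enum 'I_m -> P i)).
  by split=> [Pi i|Pi i _] //; apply: Pi; rewrite mem_enum.
rewrite /fAlls; elim: (enum 'I_m) => [|i s IH] /=; first exact: dec_true.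
apply: dec_iff (dec_and bs (dP i) IH); split=> [[Pi Ps] j|Pj].
  by rewrite inE => /predU1P[->|/Ps].
by split=> [|j sj]; apply: Pj; rewrite inE ?eqxx // sj orbT.
Qed.

Lemma and4_flat (P Q R S : Prop) : (P /\ Q) /\ (R /\ S) <-> [/\ P, Q, R & S].
Proof. by split=> [[[? ?] [? ?]]|[? ? ? ?]]. Qed.

Lemma dec_sat k (f : recfun k) n sigma xs v y b : base n sigma ->
  atoms_at n sigma xs v -> atom_at n sigma y b ->
  dec (fSat f xs y n) sigma (sat U lt rels f v b).
Proof.
elim: f n sigma xs v y b => {k} [k||k i|k m g IHg h IHh|k g IHg h IHh|k g IHg]
  n sigma xs v y b bs xv yb.
- exact: (dec_zero bs yb).
- exact: (dec_next bs (xv ord0) yb).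
- exact: (dec_atom_eq bs (xv i) yb).
- apply: dec_exs => // n' sigma' ws w le_n at' bs' ww Uw.
  apply: dec_and => //; last by apply: IHg => //; apply: at'.
  apply: dec_alls => // i; by apply: IHh => // j; apply: at'; apply: xv.
- have xh : atom_at n sigma (thead xs) (thead v) by apply: xv.
  have xt : atoms_at n sigma [tuple of behead xs] [tuple of behead v].
    move=> i; have := xv (lift ord0 i); case/tupleP: xs v {xv xh} => x xs v.
    by case/tupleP: v => a v; rewrite !tnthS !(tnth_nth 0) !(tnth_nth a).
  (* Choosing a relation in [rels] amounts to choosing an item of [V]; [P] is the clause of [RPrec]
     as a property of that item. *)
  pose P (i : item A) := if i is inr m then
    if node_view m is inr (_, N) then
      let r := rel_of [fset inr n | n in N] in
      [/\ forall i, i \in U -> zero U lt i -> forall a, a \in U -> r i a ->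
            sat U lt rels g [tuple of behead v] a,
          forall i, i \in U -> lt i (thead v) \/ i = thead v ->
            exists2 a, a \in U & r i a,
          forall i, i \in U -> lt i (thead v) ->
            forall j, j \in U -> next U lt i j ->
            forall a, a \in U -> r i a -> forall d, d \in U -> r j d ->
            sat U lt rels h [tuple of i :: a :: behead v] d
        & r (thead v) b]
      else False else False.
  apply: (@dec_iff _ _ (exists2 i, i \in V & P i)).
    split=> [[i Vi]|[r [[a [N [VN ->]]] HP]]]; last first.
      by exists (inr (elem_node a N)) => //; rewrite /P node_view_elem.
    have [a [N [eq_i _]]] := pairsV Vi; rewrite eq_i /P node_view_elem in Vi *.
    by move=> HP; exists (rel_of [fset inr n | n in N]); split=> //; exists a, N.
  apply: dec_ex => [|i0 Vi]; first by case: bs.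
  have [a0 [N [eq_i pN]]] := pairsV Vi; rewrite {}eq_i /P node_view_elem {Vi P}.
  set s1 := sigma.[_ <- _]; pose r := rel_of [fset inr m | m in N]; rewrite -/r.
  have bs1 : base n.+1 s1 by apply: base_set.
  have s1n : n < n.+1 /\ s1.[? n] = Some [fset inr (elem_node a0 N)].
    by rewrite fnd_set eqxx.
  (* [r] is read from variable [n], hence stays decided under further binders as long as [n] keeps
     its value. *)
  have rdec n' sigma' x z a d : base n' sigma' ->
      sigma'.[? n] = Some [fset inr (elem_node a0 N)] ->
      atom_at n' sigma' x a -> atom_at n' sigma' z d ->
      dec (fRel (EChildren (EVar n)) x z n') sigma' (r a d).
    move=> bs' sn; apply: (dec_rel bs' _ pN) => //.
    by have := eval_children_of n sigma' a0 N; rewrite /= sn fnd_set eqxx.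
  have keep n' (sigma' : env A) w : n < n' ->
    sigma'.[? n] = Some [fset inr (elem_node a0 N)] ->
      sigma'.[n' <- w].[? n] = Some [fset inr (elem_node a0 N)].
    by move=> lt_n; rewrite fnd_set ltn_eqF.
  (* Variable [n] keeps its value through the at most four further binders [i], [j], [a], [d]. *)
  have [_ sn1] := s1n; have sn2 w := keep n.+1 s1 w (ltnSn n) sn1.
  have sn3 w w' := keep n.+2 _ w' (leqW (ltnSn n)) (sn2 w).
  have sn4 w w' w'' := keep n.+3 _ w'' (leqW (leqW (ltnSn n))) (sn3 w w').
  have sn5 w w' w'' w3 :=
    keep n.+4 _ w3 (leqW (leqW (leqW (ltnSn n)))) (sn4 w w' w'').
  have xh1 : atom_at n.+1 s1 (thead xs) (thead v) by apply: atom_at_set.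
  have xt1 : atoms_at n.+1 s1 [tuple of behead xs] [tuple of behead v].
    exact: atoms_at_set.
  have yb1 : atom_at n.+1 s1 y b by apply: atom_at_set.
  clearbody s1.
  apply: (dec_iff (and4_flat _ _ _ _)).
  apply: dec_and => //; apply: dec_and => //.
  - apply: dec_allU => // i Ui; apply: dec_imp; [auto|apply: dec_zero; auto|].
    apply: dec_allU => [|a Ua]; first auto; apply: dec_imp; [auto|apply: rdec;
      auto|].
    by apply: IHg; auto.
  - apply: dec_allU => // i Ui; apply: dec_imp; [auto| |].
      by apply: dec_or; [apply: dec_lt; auto|apply: dec_atom_eq; auto].
    by apply: dec_exU => [|a Ua]; [auto|apply: rdec; auto].
  - apply: dec_allU => // i Ui; apply: dec_imp; [auto|apply: dec_lt; auto|].
    apply: dec_allU => [|j Uj]; first auto; apply: dec_imp; [auto|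
      apply: dec_next; auto|].
    apply: dec_allU => [|a Ua]; first auto; apply: dec_imp; [auto|apply: rdec;
      auto|].
    apply: dec_allU => [|d Ud]; first auto; apply: dec_imp; [auto|apply: rdec;
      auto 6|].
    apply: IHh; [auto 8|apply: atoms_at_cons; [auto 8|]|auto].
    by apply: atoms_at_cons; auto 8.
  - exact: rdec.
- apply: dec_and => //.
    apply: dec_exU => // a Ua; have bs1 := base_set [fset inl a] bs.
    have za := atom_at_new n sigma a.
    by apply: dec_and => //; [apply: dec_zero | apply: IHg; auto].
  apply: dec_allU => // i Ui; have bs1 := base_set [fset inl i] bs.
  have yi := atom_at_new n sigma i; have yb1 := atom_at_set [fset inl i] yb.
  apply: dec_imp => //; first exact: dec_lt.
  apply: dec_exU => // a Ua; have bs2 := base_set [fset inl a] bs1.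
  have za := atom_at_new n.+1 sigma.[n <- [fset inl i]] a.
  apply: dec_and => //; first by apply: dec_not => //; apply: dec_zero.
  by apply: IHg; auto.
Qed.

Lemma dec_linear n sigma : base n sigma ->
  dec (fLinear n) sigma (linear U lt).
Proof.
move=> bs; pose irr := forall a, a \in U -> ~ lt a a.
pose tr := forall a, a \in U -> forall b, b \in U -> forall d, d \in U ->
        lt a b -> lt b d -> lt a d.
pose tot := forall a, a \in U -> forall b, b \in U -> a = b \/ lt a b \/ lt b a.
apply: (@dec_iff _ _ (irr /\ tr /\ tot)).
  split=> [[i [t o]]|[i t o]]; first by split=> // a Ua; apply/negP/i.
  by split=> // a Ua; apply/negP/i.
apply: dec_and => //.
  apply: dec_allU => // a Ua; have bs1 := base_set [fset inl a] bs.
  by apply: dec_not => //; apply: dec_lt => //; apply: atom_at_new.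
apply: dec_and => //.
  apply: dec_allU => // a Ua; have bs1 := base_set [fset inl a] bs.
  apply: dec_allU => // b Ub; have bs2 := base_set [fset inl b] bs1.
  apply: dec_allU => // d Ud; have bs3 := base_set [fset inl d] bs2.
  have atd := atom_at_new n.+2 sigma.[n <- [fset inl a]].[n.+1 <- [fset inl b]] d.
  have atb :=
    atom_at_set [fset inl d] (atom_at_new n.+1 sigma.[n <- [fset inl a]] b).
  have ata :=
    atom_at_set [fset inl d] (atom_at_set [fset inl b] (atom_at_new n sigma a)).
  by do 2!(apply: dec_imp => //; first exact: dec_lt); apply: dec_lt.
apply: dec_allU => // a Ua; have bs1 := base_set [fset inl a] bs.
apply: dec_allU => // b Ub; have bs2 := base_set [fset inl b] bs1.
have atb := atom_at_new n.+1 sigma.[n <- [fset inl a]] b.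
have ata := atom_at_set [fset inl b] (atom_at_new n sigma a).
by apply: dec_or; [apply: dec_atom_eq|apply: dec_or; apply: dec_lt].
Qed.

End Evaluation.

(** * The type-checking instances *)

(** The domain of the type assignment must be exactly the set of free variables, so each formula is
    shown to use only variables below its level. *)
Definition below n e : Prop := forall x, x \in FV e -> x < n.

Lemma below_var n x : x < n -> below n (EVar x).
Proof. by move=> lt_x y; rewrite inE => /eqP->. Qed.

Lemma below_for n e1 e2 : below n e1 -> below n.+1 e2 -> below n (EFor n e1 e2).
Proof.
move=> b1 b2 x; rewrite !inE => /orP[/b1//|/andP[ne_x /b2]].
by rewrite ltnS leq_eqVlt (negPf ne_x).
Qed.

Lemma below_true n : 0 < n -> below n (fTrue n).
Proof. by move=> n_gt0 x; rewrite !inE orbF => /eqP->. Qed.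

Lemma below_not p n : 0 < n -> below n (p n) -> below n (fNot p n).
Proof. by move=> n_gt0 bp x; rewrite !inE !orbF => /orP[/bp|/eqP->]. Qed.

Lemma below_or p q n : below n (p n) -> below n (q n) -> below n (fOr p q n).
Proof. by move=> bp bq x; rewrite inE => /orP[/bp|/bq]. Qed.

Lemma below_and p q n : 0 < n -> below n (p n) -> below n (q n) ->
  below n (fAnd p q n).
Proof. by move=> *; apply: below_not => //; apply: below_or; apply: below_not. Qed.

Lemma below_imp p q n : 0 < n -> below n (p n) -> below n (q n) ->
  below n (fImp p q n).
Proof. by move=> *; apply: below_or => //; apply: below_not. Qed.

Lemma below_eq e1 e2 n : 0 < n -> below n e1 -> below n e2 -> below n (fEq e1 e2 n).
Proof.
by move=> n_gt0 b1 b2 x; rewrite !inE !orbF => /orP[/orP[/b1|/b2]|/eqP->].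
Qed.

Lemma below_ex e F n : below n e -> below n.+1 (F n n.+1) -> below n (fEx e F n).
Proof. exact: below_for. Qed.

Lemma below_all e F n : 0 < n -> below n e -> below n.+1 (F n n.+1) ->
  below n (fAll e F n).
Proof.
by move=> n_gt0 b1 b2; apply: below_not => //; apply: below_ex => //;
  apply: below_not.
Qed.

Lemma below_rel e x y n : 0 < n -> below n e -> x < n -> y < n ->
  below n (fRel e x y n).
Proof.
move=> n_gt0 be ltx lty; apply: below_ex => //; apply: below_ex.
  exact: below_var.
have V := below_var; apply: below_and => //; apply: below_eq => //.
- exact: (V _ n).
- by apply: V; do 2!apply: leqW.
- exact: V.
- by apply: V; do 2!apply: leqW.
Qed.

Lemma below_lt x y n : 2 < n -> x < n -> y < n -> below n (fLt x y n).
Proof. by move=> n_gt2 *; apply: below_rel => //; [apply: ltnW; apply: ltnW|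
  apply: below_var]. Qed.

Lemma below_zero x n : 2 < n -> x < n -> below n (fZero x n).
Proof.
move=> n_gt2 ltx; apply: below_not; first by apply: ltnW; apply: ltnW.
apply: below_ex; first by apply: below_var; apply: ltnW.
by apply: below_lt; rewrite // ltnW.
Qed.

Lemma below_next x y n : 2 < n -> x < n -> y < n -> below n (fNext x y n).
Proof.
move=> n_gt2 ltx lty; have n_gt0 : 0 < n by apply: ltnW; apply: ltnW.
apply: below_and => //; first exact: below_lt.
apply: below_not => //; apply: below_ex; first by apply: below_var; apply: ltnW.
have ltx' := ltnW ltx; have lty' := ltnW lty; have n_gt2' := ltnW n_gt2.
by apply: below_and => //; apply: below_lt; rewrite // ltnW.
Qed.

Lemma below_exs m : forall (F : m.-tuple nat -> form) n, 1 < n ->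
  (forall n' xs, n <= n' -> (forall i, tnth xs i < n') -> below n' (F xs n')) ->
  below n (fExs F n).
Proof.
elim: m => [|m IH] F n n_gt1 bF; first by apply: bF => // -[].
apply: below_ex; first exact: below_var.
apply: IH => [|n' xs le_n lt_xs]; first exact: ltnW.
apply: bF => [|i]; first exact: ltnW.
by case: (unliftP ord0 i) => [j ->|->]; rewrite ?tnth0 ?tnthS.
Qed.

Lemma below_alls m (F : 'I_m -> form) n : 0 < n -> (forall i, below n (F i n)) ->
  below n (fAlls F n).
Proof.
move=> n_gt0 bF; rewrite /fAlls; elim: (enum _) => [|i s IH];
  first exact: below_true.
exact: below_and.
Qed.

Lemma below_sat k (f : recfun k) xs y n : 3 < n -> (forall i, tnth xs i < n) ->
  y < n -> below n (fSat f xs y n).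
Proof.
have lt_cons m x (u : m.-tuple nat) l : x < l -> (forall i, tnth u i < l) ->
    forall i, tnth [tuple of x :: u] i < l.
  by move=> ltx ltu i; case: (unliftP ord0 i) => [j ->|->]; rewrite ?tnth0 ?tnthS.
have ltW m (u : m.-tuple nat) l : (forall i, tnth u i < l) ->
  forall i, tnth u i < l.+1.
  by move=> ltu i; apply: ltnW; apply: ltu.
elim: f n xs y =>
  {k} [k||k i|k m g IHg h IHh|k g IHg h IHh|k g IHg] n xs y n_gt3 ltxs lty;
  have [n_gt2 n_gt1 n_gt0] : [/\ 2 < n, 1 < n & 0 < n] by split;
    apply: leq_trans n_gt3.
- exact: below_zero.
- exact: below_next n_gt2 (ltxs ord0) lty.
- by apply: below_eq => //; apply: below_var.
- apply: below_exs => // n' ws le_n ltws.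
  have n_gt3' := leq_trans n_gt3 le_n.
  apply: below_and; first exact: leq_trans le_n.
    apply: below_alls => [|i]; first exact: leq_trans le_n.
    by apply: IHh => // j; apply: leq_trans le_n.
  by apply: IHg => //; apply: leq_trans le_n.
- have ltxt i : tnth [tuple of behead xs] i < n.
    have := ltxs (lift ord0 i); case/tupleP: xs {ltxs} => x xs.
    by rewrite tnthS !(tnth_nth 0).
  have ltxh : thead xs < n by apply: ltxs.
  have rel l x z : n < l -> x < l -> z < l ->
    below l (fRel (EChildren (EVar n)) x z l).
    move=> lt_n; apply: below_rel; first exact: leq_ltn_trans lt_n.
    exact: (below_var lt_n).
  have W (a l : nat) : a < l -> a < l.+1 by apply: leqW.
  have V l x : x < l -> below l (EVar x) := @below_var l x.
  apply: below_ex; first by auto.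
  have n_gt0' : 0 < n.+1 by [].
  apply: below_and => //; apply: below_and => //; first 3 last.
  + by apply: (@rel); auto.
  + apply: below_all; [by auto|by auto|]; apply: below_imp; [by auto|
    by apply: below_zero; auto|].
    apply: below_all; [by auto|by auto|]; apply: below_imp; [by auto|
      by apply: (@rel); auto 6|].
    by apply: IHg; auto 6.
  + apply: below_all; [by auto| by auto|]; apply: below_imp; [by auto| |].
      by apply: below_or; [apply: below_lt; auto|apply: below_eq; auto].
    by apply: below_ex; [auto|apply: (@rel); auto 6].
  + apply: below_all; [by auto| by auto|]; apply: below_imp; [by auto|
    by apply: below_lt; auto|].
    apply: below_all; [by auto| by auto|]; apply: below_imp; [by auto|
      by apply: below_next; auto|].
    do 2!(apply: below_all; [by auto| by auto 6|]; apply: below_imp; [by auto|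
      by apply: (@rel); auto 7|]).
    apply: IHh; [by auto 6|apply: (@lt_cons); [by auto 6|apply: (@lt_cons)]|];
      auto 7.
- apply: below_and => //.
    apply: below_ex; first exact: below_var.
    apply: below_and => //; first by apply: below_zero; rewrite // ltnW.
    by apply: IHg; rewrite // 1?ltnW //; apply: (@lt_cons); auto.
  apply: below_all; rewrite // 1?ltnW //; first exact: below_var.
  apply: below_imp => //; first by apply: below_lt; rewrite // ltnW.
  apply: below_ex; first by apply: below_var; apply: ltnW.
  have n_gt3'' : 3 < n.+2 by do 2!apply: ltnW.
  apply: below_and => //; first by apply: below_not => //; apply: below_zero;
    rewrite // ltnW.
  by apply: IHg => //; apply: (@lt_cons); auto.
Qed.

Lemma below_linear n : 2 < n -> below n (fLinear n).
Proof.
have V l x : x < l -> below l (EVar x) := @below_var l x.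
have W (a l : nat) : a < l -> a < l.+1 by apply: leqW.
move=> n_gt2; have [n_gt1 n_gt0] : 1 < n /\ 0 < n by split; apply: leq_trans n_gt2.
apply: below_and => //; last apply: below_and => //.
- by apply: below_all; [|auto|apply: below_not => //; apply: below_lt; auto].
- do 3!(apply: below_all; [by auto|by auto|]).
  by do 2!(apply: below_imp => //; first by apply: below_lt; auto 6);
    apply: below_lt; auto 6.
do 2!(apply: below_all; [by auto|by auto|]).
by apply: below_or; [apply: below_eq; auto | apply: below_or; apply: below_lt;
  auto].
Qed.

(** Sends the atom in variable 4 to its successors. A truth value is a singleton or empty, so
    looping over it acts as a conditional: variable 6 only serves as a guard. *)
Definition next_elem : expr := EFor 5 (EVar 1) (EFor 6 (fNext 4 5 6) (EVar 5)).

(* The value is the set of [m]-th elements of the universe, of which there may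
   be several when the order is not linear. *)
Fixpoint elem_expr m : expr :=
  if m is m'.+1 then EFor 4 (elem_expr m') next_elem
  else EFor 4 (EVar 1) (EFor 5 (fZero 4 5) (EVar 4)).

(** Says that [f] takes a nonzero value at the input in variable 4. The types cannot express that
    the order is linear, so the formula does, and is false in any other database. *)
Definition fTest (f : recfun 1) : form :=
  fAnd fLinear (fEx (EVar 1) (fun y => fAnd (fNot (fZero y)) (fSat f [tuple 4] y))).

(* The value is always empty; this only fixes the set of free variables. *)
Definition all_vars : expr :=
  EFor 4 EEmpty (EConcat (EVar 0) (EConcat (EVar 1) (EConcat (EVar 2) (EVar 3)))).

(** An environment may bind variable 0 to the atom concat(()), for which negation fails; the outer
    test then returns the empty value. *)
Definition test_expr e m : expr :=
  EIf (EVar 0) (EName EEmpty) all_vars (EFor 4 (elem_expr m) e).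

Definition pair_type : ntype := TyElem (Coll TyData).

Definition input_types : type_assignment :=
  [fmap].[0 <- Single TyAtom].[1 <- Coll TyAtom].[2 <- Coll (TyNode pair_type)]
        .[3 <- Coll (TyNode (TyElem (Coll pair_type)))].

(** The empty value belongs to [Coll TyAtom], whereas [truth] contains a node: the instance
    type-checks when the test is false in every environment. *)
Definition test_instance e m : instance :=
  Instance (test_expr e m) input_types (Coll TyAtom).

Lemma domf_test e m : below 5 e -> domf input_types = FV (test_expr e m).
Proof.
move=> be; have b4 : forall x, x \in FV (EFor 4 (elem_expr m) e) -> x < 4.
  apply: below_for be; elim: m => [|m IH]; apply: below_for => //.
  - exact: below_var.
  - by apply: below_for; [apply: below_zero|apply: below_var].
  apply: below_for; first exact: below_var.
  by apply: below_for; [apply: below_next|apply: below_var].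
have domE x : (x \in domf input_types) = (x < 4).
  by rewrite /input_types !dom_setf !inE; case: x => [|[|[|[]]]].
have allE x : (x \in FV all_vars) = (x < 4).
  by rewrite !inE; case: x => [|[|[|[|x]]]] //=; rewrite andbF.
apply/fsetP=> x; rewrite domE.
have -> : FV (test_expr e m) =
  [fset 0] `|` fset0 `|` FV all_vars `|` FV (EFor 4 (elem_expr m) e) by [].
move: (FV all_vars) (FV (EFor _ _ _)) allE b4 => B1 B2 B1E B2lt.
rewrite !in_fsetU B1E in_fset1 in_fset0 orbF.
case: (boolP (x \in B2)) => [/B2lt->|_]; rewrite ?orbT // orbF.
by case: x.
Qed.

(** * Evaluation of the test on typed environments *)

Section Semantics.
Variables (A : choiceType).
Variables (content : A -> {fset node A} -> A) (concat : {fset A} -> A).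

Notation ev := (eval content concat).

Lemma input_typesP (sigma : env A) : in_assignment sigma input_types ->
  exists c U L V, base c U L V 4 sigma /\ pairs L /\
    forall i, i \in V -> exists a N,
      i = inr (elem_node a N) /\ pairs [fset inr m | m in N].
Proof.
case=> eqD typ.
have look x : x < 4 -> exists v, sigma.[? x] = Some v.
  move=> lt_x; have xD : x \in domf sigma.
    by rewrite eqD /input_types !dom_setf !inE; case: x lt_x => [|[|[|[]]]].
  by exists sigma.[xD]; rewrite in_fnd.
have [v0 s0] := look 0 isT; have [v1 s1] := look 1 isT.
have [v2 s2] := look 2 isT; have [v3 s3] := look 3 isT.
have t0 := typ 0 v0 (Single TyAtom) s0; have t1 := typ 1 v1 (Coll TyAtom) s1.
have t2 := typ 2 v2 (Coll (TyNode pair_type)) s2.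
have t3 := typ 3 v3 (Coll (TyNode (TyElem (Coll pair_type)))) s3.
rewrite /input_types !fnd_set /= in t0 t1 t2 t3.
have {t0} [_ [[c ->] eq_v0]] := t0 erefl.
have {}t1 := t1 erefl; have {}t2 := t2 erefl; have {}t3 := t3 erefl.
have pair_typeP n : in_ntype pair_type n -> exists a (N : {fset node A}),
  n = elem_node a N /\
    forall m, m \in N -> exists b, m = data_node b by [].
pose proj (i : item A) := if i is inl a then Some a else None.
pose U := [fset a in pmap proj v1].
have UE a : (a \in U) = (inl a \in v1).
  rewrite inE mem_pmap; apply/mapP/idP=> [[[b|n] // v1b [->]] //|v1a].
  by exists (inl a).
exists c, U, v2, v3; split; first split=> //.
- by rewrite s0 eq_v0.
- rewrite s1; congr Some; apply/fsetP=> i; apply/idP/imfsetP=> [vi|[a /= + ->]].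
    by have [a eq_i] := t1 i vi; exists a; rewrite //= UE -eq_i.
  by rewrite UE.
split=> [i vi|i vi].
  have [n [-> /pair_typeP[a [N [-> dN]]]]] := t2 i vi.
  by exists a, N.
have [n [-> [a [N [-> tN]]]]] := t3 i vi; exists a, N; split=> // j.
case/imfsetP=> m /= Nm ->; have [b [M [-> dM]]] := pair_typeP m (tN m Nm).
by exists b, M.
Qed.

Section Structure.
Variables (c : A) (U : {fset A}) (L V : value A).
Hypothesis c_neq : c != concat fset0.
Hypothesis pairsL : pairs L.
Hypothesis pairsV : forall i, i \in V -> exists a N,
  i = inr (elem_node a N) /\ pairs [fset inr m | m in N].

Notation lt := (rel_of L).
Notation dec := (dec content concat c).
Notation base := (base c U L V).

(** Counterpart of [dec] for expressions that return sets of items instead of truth values. *)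
Definition evs e sigma (Q : item A -> Prop) : Prop :=
  exists W, ev e sigma = Some W /\ forall j, j \in W <-> Q j.

Lemma evs_iff e sigma Q Q' : (forall j, Q j <-> Q' j) -> evs e sigma Q ->
  evs e sigma Q'.
Proof.
move=> QQ' [W [eW WQ]]; exists W; split=> // j.
by split=> [/WQ/QQ'|/QQ'/WQ].
Qed.

Lemma evs_for e1 e2 n sigma Q1 Q2 : evs e1 sigma Q1 ->
  (forall i, Q1 i -> evs e2 sigma.[n <- [fset i]] (Q2 i)) ->
  evs (EFor n e1 e2) sigma (fun j => exists2 i, Q1 i & Q2 i j).
Proof.
case=> W [eW WQ] e2Q.
pose G i := odflt fset0 (ev e2 sigma.[n <- [fset i]]).
have GP i : i \in W -> ev e2 sigma.[n <- [fset i]] = Some (G i) /\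
    forall j, j \in G i <-> Q2 i j.
  by move=> /WQ/e2Q[Wi [eWi WiQ]]; rewrite /G eWi.
exists (\bigcup_(i <- W) G i); split=> [|j].
  by rewrite /= eW; apply: union_overE => i /GP[].
split=> [/bigfcupP[i /andP[Wi _] Gij]|[i /WQ Wi Qij]].
  by exists i; [exact/WQ | case: (GP i Wi) => _ /(_ j)[+ _]; apply].
apply/bigfcupP; exists i; rewrite ?Wi //.
by case: (GP i Wi) => _ /(_ j)[_]; apply.
Qed.

Lemma evs_guard e1 e2 n sigma P Q : dec e1 sigma P ->
  (forall i, evs e2 sigma.[n <- [fset i]] Q) ->
  evs (EFor n e1 e2) sigma (fun j => P /\ Q j).
Proof.
case=> [[HP eT]|[nP e0]] eQ.
  apply: (@evs_iff _ _ (fun j => exists2 i, i \in truth c & Q j)).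
    split=> [[i _ Qj]//|[_ Qj]]; exists (inr (elem_node c fset0)) => //.
    by rewrite !inE.
  by apply: evs_for => //; exists (truth c).
exists fset0; split=> [|j]; last by split=> // -[].
by rewrite /= e0 (@union_overE _ _ _ (fun=> fset0)) // big_seq_fset0.
Qed.

Lemma evs_U n sigma : base n sigma ->
  evs (EVar 1) sigma (fun i => exists2 a, a \in U & i = inl a).
Proof.
case=> _ _ s1 _ _; exists [fset inl a | a in U]; split=> // j.
by split=> [/imfsetP[a /= Ua ->]|[a Ua ->]]; [exists a | apply/imfsetP; exists a].
Qed.

Lemma evs_elem m sigma : base 4 sigma ->
  evs (elem_expr m) sigma
    (fun i => exists2 a, a \in U /\ nth_element U lt m a & i = inl a).
Proof.
move=> bs; elim: m => [|m IH].
  pose Q1 i := exists2 a, a \in U & i = inl a :> item A.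
  pose Q2 (i j : item A) := (if i is inl a then zero U lt a else False) /\ j = i.
  apply: (@evs_iff _ _ (fun j => exists2 i, Q1 i & Q2 i j)).
    move=> j; split=> [[_ [a Ua ->] [za ->]]|[a [Ua za] ->]]; first by exists a.
    by exists (inl a) => //; exists a.
  apply: evs_for => [|_ [a Ua ->]]; first exact: evs_U bs.
  apply: evs_guard => [|i].
    exact: (dec_zero content c_neq pairsL (base_set _ bs) (atom_at_new 4 sigma a)).
  exists [fset inl a]; split=> [|j]; first by rewrite /= !fnd_set.
  by split=> [/fset1P|->]; rewrite ?inE.
pose Q1 i := exists2 a, a \in U /\ nth_element U lt m a & i = inl a :> item A.
pose Q2 (i j : item A) := exists2 b, b \in U /\
  (if i is inl a then next U lt a b else False) & j = inl b.
apply: (@evs_iff _ _ (fun j => exists2 i, Q1 i & Q2 i j)).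
  move=> j; split=> [[_ [a [Ua na] ->] [b [Ub nab] ->]]|[b [Ub [a Ua [na nab]]] ->]].
    by exists b => //; split=> //; exists a.
  by exists (inl a); [exists a | exists b].
apply: evs_for => [|_ [a [Ua na] ->]]; first exact: IH.
pose Q3 i := exists2 a, a \in U & i = inl a :> item A.
pose Q4 (i j : item A) := (if i is inl b then next U lt a b else False) /\ j = i.
apply: (@evs_iff _ _ (fun j => exists2 i, Q3 i & Q4 i j)).
  move=> j; split=> [[_ [b Ub ->] [nb ->]]|[b [Ub nb] ->]]; first by exists b.
  by exists (inl b) => //; exists b.
have bs1 := base_set [fset inl a] bs.
apply: evs_for => [|_ [b Ub ->]]; first exact: evs_U bs1.
apply: evs_guard => [|i].
  apply: (dec_next content c_neq pairsL (base_set _ bs1) _ (atom_at_new 5 _ b)).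
  exact/atom_at_set/atom_at_new.
exists [fset inl b]; split=> [|j]; first by rewrite /= !fnd_set.
by split=> [/fset1P|->]; rewrite ?inE.
Qed.

Lemma dec_test f m sigma : base 4 sigma ->
  dec (EFor 4 (elem_expr m) (fTest f 5)) sigma
    (exists2 a, a \in U /\ nth_element U lt m a &
      linear U lt /\ exists2 b, b \in U &
        ~ zero U lt b /\ sat U lt (rels V) f [tuple a] b).
Proof.
move=> bs; have [W [eW WQ]] := evs_elem m bs.
pose P (i : item A) := if i is inl a then linear U lt /\
  exists2 b, b \in U & ~ zero U lt b /\ sat U lt (rels V) f [tuple a] b else False.
apply: (@dec_iff _ _ _ _ _ _ (exists2 i, i \in W & P i)).
  split=> [[i /WQ[a [Ua na] ->] Pi]|[a Ua Pa]]; first by exists a.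
  by exists (inl a) => //; apply/WQ; exists a.
apply: (dec_ex (F := fun _ => fTest f)) => // _ /WQ[a [Ua na] ->].
have bs1 := base_set [fset inl a] bs; have ata := atom_at_new 4 sigma a.
rewrite /P; apply: (dec_and c_neq bs1);
  first exact: (dec_linear content c_neq pairsL bs1).
apply: (dec_exU bs1) => b Ub; have bs2 := base_set [fset inl b] bs1.
have atb := atom_at_new 5 sigma.[4 <- [fset inl a]] b.
apply: (dec_and c_neq bs2).
  exact: (dec_not c_neq bs2 (dec_zero content c_neq pairsL bs2 atb)).
apply: (dec_sat content c_neq pairsL pairsV f bs2 _ atb) => i.
by rewrite ord1; apply: atom_at_set.
Qed.

End Structure.

End Semantics.

(** * Diagonalization *)

(** The code of [test_instance e m] for the expression [e] with code [m], that is, of the instance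
    in which [e] is run on its own code. The tags 7 and 6 are those of [EIf] and [EFor]. *)
Definition diag m : nat :=
  npair (npair 7 (npair (code_expr (EVar 0)) (npair (code_expr (EName EEmpty))
    (npair (code_expr all_vars)
      (npair 6 (npair 4 (npair (code_expr (elem_expr m)) m)))))))
    (npair (code_assignment input_types) (code_rxtype (Coll TyAtom))).

Lemma code_test_instance e :
  code_instance (test_instance e (code_expr e)) = diag (code_expr e).
Proof.
(* Rewriting with these two equations unfolds only the outer constructors of the code. *)
have code_if e1 e2 e3 e4 : code_expr (EIf e1 e2 e3 e4) =
    npair 7 (npair (code_expr e1) (npair (code_expr e2)
      (npair (code_expr e3) (code_expr e4)))) by [].
have code_for x e1 e2 : code_expr (EFor x e1 e2) =
    npair 6 (npair x (npair (code_expr e1) (code_expr e2))) by [].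
by rewrite /diag /code_instance [inst_expr _]/(test_expr _ _) code_if code_for.
Qed.

(** Besides the final [m], the argument enters through the code of [elem_expr m] alone, which is
    obtained by iterating a fixed operation on codes [m] times. *)
Lemma computable_diag : computable (fun v : 1.-tuple nat => diag (thead v)).
Proof.
have const k n : computable (fun _ : k.-tuple nat => n) := computable_const k n.
have iter k0 kn : computable (fun v : 1.-tuple nat =>
    iteri (thead v) (fun _ s => npair 6 (npair 4 (npair s kn))) k0).
  have step : computable (fun v : 2.-tuple nat =>
      npair 6 (npair 4 (npair (tnth v ord_max) kn))).
    do 2!apply: (computable_npair (const _ _)).
    exact: (computable_npair (computable_proj _) (const _ _)).
  exact: (computable_iteri (H := fun _ s => npair 6 (npair 4 (npair s kn)))
    (const 0 k0) step).
have elemE m : iteri m (fun _ s =>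
  npair 6 (npair 4 (npair s (code_expr next_elem))))
    (code_expr (elem_expr 0)) = code_expr (elem_expr m).
  by elim: m => // m IH; rewrite iteriS IH.
have elems := eq_computable (fun v => elemE (thead v)) (iter _ _).
rewrite /diag; move: (code_expr _) (code_expr _) (code_expr all_vars) => k1 k2 k3.
apply: computable_npair (const _ _).
do 6!apply: (computable_npair (const _ _)).
exact: (computable_npair elems (computable_proj ord0)).
Qed.

Lemma inr_elem_node_inj (A : choiceType) (a b : A) M N :
  inr (elem_node a M) = inr (elem_node b N) :> item A -> a = b /\ M = N.
Proof. by move=> eq_ab; apply: elem_node_inj; apply: (inr_inj eq_ab). Qed.

Lemma revalto_comp1 k (g : recfun 1) (h : recfun k) (H : k.-tuple nat -> nat) :
  (forall v, revalto h v (H v)) ->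
  forall v y, revalto (RComp g (fun _ : 'I_1 => h)) v y <-> revalto g [tuple H v] y.
Proof.
move=> hP v y; split=> [[w [hw gw]]|gy].
  rewrite (_ : [tuple _] = w) //; apply: eq_from_tnth => i.
  by rewrite ord1; apply: revalto_functional (hP v) (hw ord0).
by exists [tuple H v]; split=> // i; rewrite ord1; apply: hP.
Qed.

(** * Canonical databases as typed environments *)

Section Inputs.
Variables (A : choiceType) (en : nat -> A).
Hypothesis en_inj : injective en.
Variables (c : A) (N : nat) (D : seq (seq nat)).

Definition atoms_value : {fset A} := [fset en i | i in iota 0 N].

Definition pair_node a b : node A := elem_node a [fset data_node b].

Definition order_value : value A :=
  [fset inr (elem_node (en i) [fset data_node (en j) | j in iota i.+1 (N - i.+1)])
  | i in iota 0 N].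

(** The graph of the sequence: pairing values with positions retains the order and the repetitions
    that a set would lose. *)
Definition seq_children (s : seq nat) : {fset node A} :=
  [fset pair_node (en i) (en (nth 0 s i)) | i in iota 0 (size s)].

Definition seq_node s : node A := elem_node c (seq_children s).

Definition seqs_value : value A := [fset inr (seq_node s) | s in D].

Definition input_env : env A :=
  [fmap].[0 <- [fset inl c]].[1 <- [fset inl a | a in atoms_value]]
        .[2 <- order_value].[3 <- seqs_value].

Lemma base_input : base c atoms_value order_value seqs_value 4 input_env.
Proof. by split; rewrite // /input_env !fnd_set. Qed.

Lemma input_env_typed : in_assignment input_env input_types.
Proof.
have pair_typed a (M : {fset node A}) : (forall m, m \in M -> exists b,
  m = data_node b) ->
    in_ntype pair_type (elem_node a M) by move=> dM; exists a, M.
split; first by rewrite /input_env /input_types !dom_setf.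
move=> x v tau; rewrite /input_env /input_types !fnd_set.
case: eqP => [_ [<-] [<-] i|_].
  case/imfsetP=> s _ ->; exists (seq_node s); split=> //.
  exists c, (seq_children s).
  split=> // _ /imfsetP[j _ ->]; apply: pair_typed => m.
  by rewrite inE => /eqP->; eexists.
case: eqP => [_ [<-] [<-] i|_].
  case/imfsetP=> j _ ->; eexists; split; first by [].
  by apply: pair_typed => _ /imfsetP[l _ ->]; eexists.
case: eqP => [_ [<-] [<-] i|_]; first by case/imfsetP=> a _ ->; exists a.
case: eqP => [_ [<-] [<-]|_]; first by exists (inl c); split=> //; exists c.
by rewrite not_fnd // in_fset0.
Qed.

Lemma rel_ofP (v : value A) a b : pairs v ->
  reflect (exists2 M, inr (elem_node a M) \in v & data_node b \in M) (rel_of v a b).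
Proof.
move=> pv; apply: (iffP hasP) => [[i vi]|[M vM Mb]].
  have [a' [M [eq_i _]]] := pv i vi; rewrite eq_i node_view_elem in vi *.
  by case/andP=> /eqP <- Mb; exists M.
by exists (inr (elem_node a M)) => //; rewrite node_view_elem eqxx.
Qed.

Lemma pairs_order : pairs order_value.
Proof.
move=> _ /imfsetP[i _ ->]; do 2!eexists; split; first by [].
by move=> _ /imfsetP[j _ ->]; eexists.
Qed.

Lemma pairs_seq s : pairs [fset inr m | m in seq_children s].
Proof.
move=> _ /imfsetP[_ /imfsetP[i _ ->] ->]; do 2!eexists; split; first by [].
by move=> m; rewrite inE => /eqP->; eexists.
Qed.

Lemma canonical_input : canonical_model en N D atoms_value (rel_of order_value)
  (rels seqs_value).
Proof.
split=> [//|i j ltiN ltjN|s Ds].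
  apply/(rel_ofP _ _ pairs_order)/idP=>
    [[M /imfsetP[l _ /inr_elem_node_inj[/en_inj<- ->]]]|lt_ij].
    by case/imfsetP=> m; rewrite /= mem_iota =>
      /andP[lt_im _] /data_node_inj/en_inj->.
  exists [fset data_node (en j) | j in iota i.+1 (N - i.+1)].
    by apply/imfsetP; exists i; rewrite //= mem_iota.
  by apply/imfsetP; exists j; rewrite //= mem_iota lt_ij subnKC.
exists (rel_of [fset inr m | m in seq_children s]); split.
  by exists c, (seq_children s); split=> //; apply/imfsetP; exists s.
move=> i b; apply/(rel_ofP _ _ (@pairs_seq s))/andP=> [[K]|[lt_i /eqP->]].
  case/imfsetP=> _ /imfsetP[j /= js ->] /inr_elem_node_inj[/en_inj-> ->].
  by move/fset1P/data_node_inj->; rewrite mem_iota in js.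
exists [fset data_node (en (nth 0 s i))]; last by rewrite inE.
apply/imfsetP; exists (pair_node (en i) (en (nth 0 s i))) => //.
by apply/imfsetP; exists i; rewrite //= mem_iota.
Qed.

End Inputs.

(** Each new atom is chosen outside the list of all earlier ones. *)
Lemma injection_of_infinite (A : choiceType) :
  (forall s : seq A, exists a, a \notin s) -> exists en : nat -> A, injective en.
Proof.
move=> inf; pose fresh s := xchoose (inf s).
pose prefix n := iter n (fun s => fresh s :: s) [::].
have en_prefix m n : m < n -> fresh (prefix m) \in prefix n.
  elim: n => // n IH; rewrite ltnS leq_eqVlt inE => /predU1P[->|/IH->].
    by rewrite eqxx.
  exact: orbT.
exists (fresh \o prefix) => m n /= eq_mn.
have fresh_notin s : fresh s \notin s := xchooseP (inf s).
case: (ltngtP m n) => // /en_prefix; first by rewrite eq_mn (negPf (fresh_notin _)).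
by rewrite -eq_mn (negPf (fresh_notin _)).
Qed.

(** * Correctness of the test instances *)

Section Test.
Variables (A : choiceType).
Variables (content : A -> {fset node A} -> A) (concat : {fset A} -> A).
Variables (f : recfun 1) (m : nat).

Let I := test_instance (fTest f 5) m.
Notation ev := (eval content concat).

Lemma eval_test c U L V sigma : base c U L V 4 sigma ->
  ev (inst_expr I) sigma = if c == concat fset0 then ev all_vars sigma
    else ev (EFor 4 (elem_expr m) (fTest f 5)) sigma.
Proof.
case=> _ s0 _ _ _; rewrite /I /test_instance /inst_expr /test_expr.
set e1 := all_vars; set e2 := EFor _ _ _; rewrite /= s0 /=.
by rewrite !data_one !fset_the_one.
Qed.

(** A nonempty value can only come from a linear database in which [f] relates the [m]-th element to
    a nonzero [b]; by [sat_sound], the rank of [b] is then a nonzero value of [f] at [m]. *)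
Lemma test_sound sigma : in_assignment sigma input_types ->
  (exists v, ev (inst_expr I) sigma = Some v) /\
  ((forall y, revalto f [tuple m] y -> y = 0) ->
    ev (inst_expr I) sigma = Some fset0).
Proof.
move=> /input_typesP[c [U [L [V [bs [pL pV]]]]]].
have e0 : ev all_vars sigma = Some fset0.
  by rewrite /= /union_over /= big_seq_fset0.
rewrite (eval_test bs); case: eqP => [_|/eqP c_neq]; first by split;
  [exists fset0|].
case: (dec_test content c_neq pL pV f m bs) => [[]|[_ ->]]; last first.
  by split; [exists fset0|].
move=> [a [Ua na] [lin [b Ub [nzb sab]]]] ->; split; first by exists (truth c).
move=> f0; case: nzb; apply/(zeroP lin) => //; apply: f0.
have := sat_sound lin _ Ub sab; rewrite -(rank_nth_element lin Ua na).
have -> : [tuple of map (rank U (rel_of L)) [tuple a]] = [tuple rank U (rel_of L) a].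
  exact: val_inj.
by apply => i; rewrite ord1.
Qed.

(** Infinity of the atoms supplies both the numbering [en] and an atom [c] other than concat(());
    the database is a canonical one given by [sat_complete]. *)
Lemma test_complete : (forall s : seq A, exists a, a \notin s) ->
  revalto f [tuple m] 1 ->
  exists sigma c, in_assignment sigma input_types /\
    ev (inst_expr I) sigma = Some (truth c).
Proof.
move=> inf f1; have [en en_inj] := injection_of_infinite inf.
have [c] := inf [:: concat fset0]; rewrite inE => c_neq.
have [N [D]] :=
  eventually_and (eventually_model en (m + 2) [::]) (sat_complete en_inj f1).
(* Length [m + 2] puts both the input [en m] and the output [en 1] into the universe. *)
have leN : m + 2 <= maxn N (m + 2) by apply: leq_maxr.
move=> /(_ _ _ _ _ (leq_maxl N (m + 2)) (canonical_input en_inj c _ D)).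
set M := maxn N _ in leN *; case=> _ s1; have mod := canonical_input en_inj c M D.
exists (input_env en c M D), c; split; first exact: input_env_typed.
have bs := base_input en c M D.
rewrite (eval_test bs) (negPf c_neq).
have pV i : i \in seqs_value en c D -> exists a N,
    i = inr (elem_node a N) /\ pairs [fset inr m | m in N].
  by case/imfsetP=> s _ ->; do 2!eexists; split; [|exact: pairs_seq].
case: (dec_test content c_neq (@pairs_order _ en M) pV f m bs) => [[]//|[[]]].
have ltm : m < M by apply: leq_trans leN; rewrite addn2 ltnW.
have lt1 : 1 < M by apply: leq_trans leN; rewrite addn2.
exists (en m); first by split; [exact: canonical_in mod _ _ |
  exact: canonical_nth_element mod _ _].
split; first exact: canonical_linear mod.
exists (en 1); first exact: canonical_in mod _ _.
split; first by move/(canonical_zero mod lt1).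
by move: s1; congr sat; apply: val_inj.
Qed.

Lemma test_valid : valid_instance content concat I.
Proof.
split=> [|sigma /test_sound[+ _]]; last exact.
apply: domf_test; apply: below_and => //; first exact: below_linear.
apply: below_ex; first exact: below_var.
apply: below_and => //; first by apply: below_not => //; apply: below_zero.
by apply: below_sat => // i; rewrite ord1.
Qed.

Lemma test_checks : (forall y, revalto f [tuple m] y -> y = 0) ->
  type_checks content concat I.
Proof.
move=> f0 sigma /test_sound[_ /(_ f0) ->].
by exists fset0.
Qed.

Lemma test_fails : (forall s : seq A, exists a, a \notin s) ->
  revalto f [tuple m] 1 -> ~ type_checks content concat I.
Proof.
move=> inf /(test_complete inf)[sigma [c [typed evT]]] /(_ sigma typed).
rewrite evT => -[_ [[<-] /(_ (inr (elem_node c fset0)))]].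
by rewrite inE eqxx => /(_ isT)[].
Qed.

End Test.

Theorem corollary3 (A : countType) (A_infinite_re : infinite_re A)
    (content : A -> {fset node A} -> A)
    (content_computable : computable_content content)
    (concat : {fset A} -> A)
    (concat_computable : computable_concat concat) :
  ~ exists f : recfun 1,
      decides_under code_instance (valid_instance content concat)
        (type_checks content concat) f.
Proof.
case=> f fP; have [inf _] := A_infinite_re; have [d dP] := computable_diag.
(* At the code of an expression [e], [F] is the answer of [f] to the instance running [e] on that
   code; [e] is then taken to be the test for [F] itself. *)
pose F := RComp f (fun _ : 'I_1 => d).
pose e := fTest F 5;
  (* Abstracting the code at once prevents it from being evaluated in unary. *)
move: (code_expr e) (code_test_instance e) => m codeE.
have FE y : revalto f [tuple diag m] y <-> revalto F [tuple m] y.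
  exact: iff_sym (revalto_comp1 f dP [tuple m] y).
move: (diag m) codeE FE => q codeE FE.
have := test_valid content concat F m; have := @test_fails _ content concat F m inf.
have := @test_checks _ content concat F m.
move: (test_instance _ m) codeE => I codeE checks fails /fP[].
(* If the instance type-checked, the answer would be 1 and the test would succeed in some
   environment. So it does not type-check, the answer 0 is the only value of [F] at [m], and
   therefore it type-checks. *)
rewrite codeE => f1 f0; have nTC : ~ type_checks content concat I.
  by move=> TC; apply: (fails _ TC); apply/FE/f1.
by apply/nTC/checks => y Fy; apply: revalto_functional Fy _; apply/FE/f0.
Qed.
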